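(* Let $\Omega\subset\mathbb{C}^n$ be a bounded domain and let $1\le p<q\le\infty$. If $E$ is a closed subspace of $A^p(\Omega)$ (with respect to the $L^p$-norm) and $E\subset A^q(\Omega)$, then $\dim E<\infty$.
   Context: For $1\le p<\infty$, $A^p(\Omega)=\{f\in\mathcal{O}(\Omega): \int_\Omega |f|^p\,dV<\infty\}$, where $\mathcal{O}(\Omega)$ is the space of holomorphic functions on $\Omega$ and $dV$ is Lebesgue measure; it is normed by $\|f\|_p=(\int_\Omega|f|^p\,dV)^{1/p}$. $A^\infty(\Omega)=\mathcal{O}(\Omega)\cap L^\infty(\Omega)$. *)

(* Defs.v *)
From HB Require Import structures.
From mathcomp Require Import all_boot all_order all_algebra.
From mathcomp Require Import all_classical all_reals all_analysis.
From mathcomp Require Import complex.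
Set Implicit Arguments.
Unset Strict Implicit.
Unset Printing Implicit Defensive.
Import Order.TTheory GRing.Theory Num.Theory.
Import numFieldNormedType.Exports.
Local Open Scope classical_set_scope.
Local Open Scope ring_scope.

Section Cn.
Variables (R : realType) (n : nat).

Definition Cn := 'I_n -> R[i].
HB.instance Definition _ := gen_eqMixin Cn.
HB.instance Definition _ := gen_choiceMixin Cn.
HB.instance Definition _ := isPointed.Build Cn (fun=> 0).

Definition cabs (z : R[i]) : R := Num.sqrt (complex.Re z ^+ 2 + complex.Im z ^+ 2).

(** sup-norm distance on C^n (induces the Euclidean topology) *)
Definition cdist (z w : Cn) : R := \big[Num.max/0]_(j < n) cabs (z j - w j).

Definition Cn_open (U : set Cn) : Prop :=
  forall z, U z -> exists2 e : R, 0 < e & forall w, cdist w z < e -> U w.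

Definition CnB : measurableType (sigma_display Cn_open) := g_sigma_algebraType Cn_open.

Definition Cn_domain (O : set Cn) : Prop :=
  [/\ Cn_open O, O !=set0 &
      forall U V : set Cn, Cn_open U -> Cn_open V -> O `<=` U `|` V ->
        O `&` U `&` V = set0 -> O `&` U = set0 \/ O `&` V = set0].

Definition Cn_bounded (O : set Cn) : Prop :=
  exists M : R, forall z, O z -> cdist z (fun=> 0) <= M.

Definition Cn_box (a b c d : 'I_n -> R) : set CnB :=
  [set z : CnB | forall j, a j <= complex.Re (z j) <= b j /\ c j <= complex.Im (z j) <= d j].

(** mu is Lebesgue measure on C^n = R^(2n) (on Borel sets): it gives every
    closed box its Euclidean volume.  This determines mu uniquely. *)
Definition is_lebesgue_Cn (mu : {measure set CnB -> \bar R}) : Prop :=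
  forall a b c d : 'I_n -> R, (forall j, a j <= b j /\ c j <= d j) ->
    mu (Cn_box a b c d) = (\prod_(j < n) ((b j - a j) * (d j - c j)))%:E.

Definition holomorphic_on (O : set Cn) (f : Cn -> R[i]) : Prop :=
  forall z, O z -> exists a : 'I_n -> R[i],
    forall e : R, 0 < e -> exists2 dl : R, 0 < dl & forall w : Cn,
      cdist w z < dl ->
      cabs (f w - f z - \sum_(j < n) a j * (w j - z j)) <= e * cdist w z.

Definition int_pow (mu : {measure set CnB -> \bar R}) (O : set Cn) (p : R)
    (f : Cn -> R[i]) : \bar R :=
  (\int[mu]_(z in (O : set CnB)) (cabs (f z) `^ p)%:E)%E.

Definition Lp_norm (mu : {measure set CnB -> \bar R}) (O : set Cn) (p : R)
    (f : Cn -> R[i]) : \bar R := (int_pow mu O p f `^ p^-1)%E.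

Definition Bergman (mu : {measure set CnB -> \bar R}) (O : set Cn) (q : \bar R)
    (f : Cn -> R[i]) : Prop :=
  holomorphic_on O f /\
  match q with
  | r%:E => (int_pow mu O r f < +oo)%E
  | +oo%E => exists M : R, {ae mu, forall z : CnB, O z -> cabs (f z) <= M}
  | -oo%E => False
  end.

(** E is a C-linear subspace of A^p(O) (functions are identified when they
    agree on O) *)
Definition Bergman_subspace mu O (p : R) (E : set (Cn -> R[i])) : Prop :=
  [/\ forall f, E f -> Bergman mu O p%:E f,
      E (fun=> 0),
      forall f g, E f -> E g -> E (fun z => f z + g z) &
      forall (c : R[i]) f, E f -> E (fun z => c * f z)].

Definition Bergman_closed mu O (p : R) (E : set (Cn -> R[i])) : Prop :=
  forall (u : nat -> Cn -> R[i]) (f : Cn -> R[i]),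
    (forall k, E (u k)) -> Bergman mu O p%:E f ->
    Lp_norm mu O p (fun z => u k z - f z) @[k --> \oo] --> 0%E ->
    exists2 g, E g & forall z, O z -> g z = f z.

Definition finite_dim_on (O : set Cn) (E : set (Cn -> R[i])) : Prop :=
  exists s : seq (Cn -> R[i]), forall f, E f ->
    exists c : nat -> R[i], forall z, O z ->
      f z = \sum_(k < size s) c k * nth (fun=> 0) s k z.

End Cn.

(* Main.v *)
(** For [z] at distance at least [d] from the complement of [O], [|f z|^p] is at
    most a constant depending on [d] times the integral of [|f|^p]. Hence, by a
    gliding hump argument (which uses that [E] is closed, and that locally
    uniform limits of holomorphic functions are holomorphic), the [L^q] norm is
    dominated by the [L^p] norm on [E] (finite [q] is enough, since [O] is
    bounded). The functions of [E] therefore cannot concentrate near the boundary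
    of [O]: for some inner set [K], the integral of [|f|^p] over [O] is at most
    twice the integral over [K] for every [f] in [E]. On [K] the functions of [E]
    are Lipschitz with a constant controlled by their [L^p] norm, so a function
    of [E] which vanishes on a sufficiently fine finite net of [K] is zero, and
    evaluation on this net embeds [E] in a finite-dimensional space.

    The only fact needed about holomorphic functions is the Lipschitz estimate
    [|f w - f z| <= C (sup |f|) |w - z| / r]. Since complex differentiability is
    assumed without continuity of the derivative, it rests on Goursat's argument,
    carried out on midpoint Riemann sums along squares, so that no integral of a
    complex function is ever formed. *)

Require Import Defs.
From HB Require Import structures.
From mathcomp Require Import all_boot all_order all_algebra.
From mathcomp Require Import all_classical all_reals all_analysis.
From mathcomp Require Import measurable_realfun complex.
From mathcomp Require Import ring lra.
Set Implicit Arguments.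
Unset Strict Implicit.
Unset Printing Implicit Defensive.
Import Order.TTheory GRing.Theory Num.Theory.
Import numFieldNormedType.Exports.
Local Open Scope classical_set_scope.
Local Open Scope ring_scope.

(** * The modulus of complex numbers *)

Section ComplexModulus.
Variable R : realType.
Implicit Types (x y z : R[i]) (r : R).
Notation Re := complex.Re.
Notation Im := complex.Im.
Import ComplexField.Normc.

Lemma cabsE z : cabs z = normc z.
Proof. by case: z. Qed.

Lemma cabs_ge0 z : 0 <= cabs z.
Proof. exact: sqrtr_ge0. Qed.

Lemma cabs0 : cabs (0 : R[i]) = 0.
Proof. by rewrite cabsE normc0. Qed.

Lemma cabs0_eq0 z : cabs z = 0 -> z = 0.
Proof. by rewrite cabsE => /eq0_normc. Qed.

Lemma cabs_gt0 z : z != 0 -> 0 < cabs z.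
Proof.
move=> z0; rewrite lt_neqAle cabs_ge0 andbT eq_sym.
by apply: contra z0 => /eqP /cabs0_eq0 ->.
Qed.

Lemma cabsM x y : cabs (x * y) = cabs x * cabs y.
Proof. by rewrite !cabsE normcM. Qed.

Lemma cabsV z : cabs z^-1 = (cabs z)^-1.
Proof. by rewrite !cabsE normcV. Qed.

Lemma cabsN z : cabs (- z) = cabs z.
Proof. by rewrite !cabsE normcN. Qed.

Lemma cabsC x y : cabs (x - y) = cabs (y - x).
Proof. by rewrite -cabsN opprB. Qed.

Lemma cabsD x y : cabs (x + y) <= cabs x + cabs y.
Proof. by rewrite !cabsE le_normcD. Qed.

Lemma cabsB x y : cabs (x - y) <= cabs x + cabs y.
Proof. by rewrite -[cabs y]cabsN cabsD. Qed.

Lemma cabs_le_add x y : cabs x <= cabs y + cabs (x - y).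
Proof. by rewrite -{1}(subrK y x) addrC cabsD. Qed.

Lemma cabs_real r : cabs (real_complex R r) = `|r|.
Proof. by rewrite /cabs /= expr0n addr0 sqrtr_sqr. Qed.

Lemma cabs_sum (I : Type) (s : seq I) (P : pred I) (F : I -> R[i]) :
  cabs (\sum_(i <- s | P i) F i) <= \sum_(i <- s | P i) cabs (F i).
Proof.
elim/big_rec2: _ => [|i a b _ h]; first by rewrite cabs0.
by apply: le_trans (cabsD _ _) _; rewrite lerD2l.
Qed.

Lemma abs_Re_le z : `|Re z| <= cabs z.
Proof.
by rewrite -sqrtr_sqr /cabs ler_sqrt ?addr_ge0 ?sqr_ge0// lerDl sqr_ge0.
Qed.

Lemma abs_Im_le z : `|Im z| <= cabs z.
Proof.
by rewrite -sqrtr_sqr /cabs ler_sqrt ?addr_ge0 ?sqr_ge0// lerDr sqr_ge0.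
Qed.

Lemma cabs_le_ReIm z : cabs z <= `|Re z| + `|Im z|.
Proof.
rewrite -[leRHS]ger0_norm ?addr_ge0// -sqrtr_sqr ler_sqrt ?sqr_ge0//.
rewrite -(real_normK (num_real (Re z))) -(real_normK (num_real (Im z))).
by rewrite sqrrD; have := mulr_ge0 (normr_ge0 (Re z)) (normr_ge0 (Im z)); lra.
Qed.

Lemma ReB x y : Re (x - y) = Re x - Re y.
Proof. by case: x; case: y. Qed.
Lemma ImB x y : Im (x - y) = Im x - Im y.
Proof. by case: x; case: y. Qed.
Lemma ReD x y : Re (x + y) = Re x + Re y.
Proof. by case: x; case: y. Qed.
Lemma ImD x y : Im (x + y) = Im x + Im y.
Proof. by case: x; case: y. Qed.
Lemma ReZ r z : Re (real_complex R r * z) = r * Re z.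
Proof. by case: z => a b /=; rewrite mul0r subr0. Qed.
Lemma ImZ r z : Im (real_complex R r * z) = r * Im z.
Proof. by case: z => a b /=; rewrite mul0r addr0. Qed.
Lemma Re_inv z : Re z^-1 = Re z / cabs z ^+ 2.
Proof.
by case: z => a b; rewrite /cabs sqr_sqrtr ?addr_ge0 ?sqr_ge0.
Qed.

Lemma Im_inv z : Im z^-1 = - Im z / cabs z ^+ 2.
Proof.
case: z => a b; rewrite /cabs sqr_sqrtr ?addr_ge0 ?sqr_ge0//=.
by rewrite mulNr.
Qed.

(* The oscillation bound [eps i + eps j] needs no monotonicity of [eps]; the
   limit is the supremum of the lower bounds [u k - eps k]. *)
Lemma real_limit (u eps : nat -> R) :
  (forall k l, `|u k - u l| <= eps k + eps l) ->
  exists t : R, forall k, `|u k - t| <= eps k.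
Proof.
move=> h; pose A := [set u k - eps k | k in [set: nat]].
have ub k : ubound A (u k + eps k).
  by move=> _ [l _ <-]; have := h l k; rewrite ler_norml => /andP[_]; lra.
exists (sup A) => k; rewrite ler_norml; apply/andP; split.
  have : sup A <= u k + eps k by apply: ge_sup => //; exists (u 0 - eps 0)%R, 0%N.
  lra.
have : u k - eps k <= sup A by apply: ub_le_sup; [exists (u 0%N + eps 0%N) | exists k].
lra.
Qed.

Lemma complex_limit (u : nat -> R[i]) (eps : nat -> R) :
  (forall k l, cabs (u k - u l) <= eps k + eps l) ->
  exists x, forall k, cabs (u k - x) <= 2 * eps k.
Proof.
move=> h.
have [k l|a ha] := @real_limit (fun k => Re (u k)) eps.
  by rewrite -ReB; apply: le_trans (abs_Re_le _) (h k l).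
have [k l|b hb] := @real_limit (fun k => Im (u k)) eps.
  by rewrite -ImB; apply: le_trans (abs_Im_le _) (h k l).
exists (Complex a b) => k; apply: le_trans (cabs_le_ReIm _) _.
by rewrite ReB ImB /=; have := ha k; have := hb k; lra.
Qed.

Lemma archi_pow2 r : exists k, r < 2 ^+ k.
Proof.
exists (Num.bound `|r|); apply: lt_trans (_ : (Num.bound `|r|)%:R < _).
  exact: le_lt_trans (ler_norm _) (archi_boundP (normr_ge0 _)).
by rewrite -natrX ltr_nat ltn_expl.
Qed.

Lemma exp2V_small r : 0 < r -> exists k, forall m, (k <= m)%N -> (2^-1) ^+ m < r.
Proof.
move=> r0; have [k hk] := archi_pow2 r^-1; exists k => m km.
apply: le_lt_trans (_ : 2^-1 ^+ k < r); last first.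
  by rewrite exprVn -(invrK r) ltf_pV2 ?posrE ?exprn_gt0 ?invr_gt0.
by apply: ler_wiXn2l => //; lra.
Qed.

End ComplexModulus.

(** * Goursat's argument and the Cauchy estimate *)

Section Goursat.
Variable R : realType.
Notation C := R[i].
Notation Re := complex.Re.
Notation Im := complex.Im.
Notation rc := (real_complex R).
Notation ii := (Complex 0 1 : R[i]).
Implicit Types (h : C -> C) (a l t e : C) (L s : R) (N m : nat).

Definition cdiff h t := exists b : C, forall eps : R, 0 < eps ->
  exists2 d : R, 0 < d &
    forall t', cabs (t' - t) < d -> cabs (h t' - h t - b * (t' - t)) <= eps * cabs (t' - t).

Definition csquare a L : set C :=
  [set t | Re a <= Re t <= Re a + L /\ Im a <= Im t <= Im a + L].

Definition cframe a L : set C := [set t | csquare a L t /\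
  [\/ Re t = Re a, Re t = Re a + L, Im t = Im a | Im t = Im a + L]].

Definition edge_sum h a l N : C := \sum_(j < N) h (a + rc (j%:R + 2^-1) * l) * l.

(* Midpoint rule for the contour integral of [h] along the boundary of the
   square with lower left corner [a] and side [N * l]. *)
Definition boundary_sum h a l N : C :=
  edge_sum h a l N + edge_sum h (a + rc N%:R * l) (ii * l) N
  - edge_sum h (a + rc N%:R * (ii * l)) l N - edge_sum h a (ii * l) N.

Lemma edge_sum_cat h a l N M :
  edge_sum h a l (N + M) = edge_sum h a l N + edge_sum h (a + rc N%:R * l) l M.
Proof.
rewrite /edge_sum big_split_ord /=; congr (_ + _); apply: eq_bigr => j _.
by congr (h _ * _); rewrite natrD; ring.
Qed.

(** All four sub-squares use the same step [l], so an inner edge shared by two of them carries the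
    same nodes with opposite signs and cancels exactly. *)
Lemma boundary_sum_split h a l N :
  boundary_sum h a l (N + N) =
  boundary_sum h a l N + boundary_sum h (a + rc N%:R * l) l N
  + boundary_sum h (a + rc N%:R * (ii * l)) l N
  + boundary_sum h (a + rc N%:R * l + rc N%:R * (ii * l)) l N.
Proof.
rewrite /boundary_sum !edge_sum_cat.
have -> : rc (N + N)%:R = rc N%:R + rc N%:R by rewrite natrD rmorphD.
rewrite !mulrDl !addrA.
have -> : a + rc N%:R * (ii * l) + rc N%:R * (ii * l) + rc N%:R * l
        = a + rc N%:R * l + rc N%:R * (ii * l) + rc N%:R * (ii * l) by ring.
have -> : a + rc N%:R * (ii * l) + rc N%:R * l
        = a + rc N%:R * l + rc N%:R * (ii * l) by ring.
have -> : a + rc N%:R * l + rc N%:R * (ii * l) + rc N%:R * l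
        = a + rc N%:R * l + rc N%:R * l + rc N%:R * (ii * l) by ring.
ring.
Qed.

Lemma boundary_sumE h a l N : boundary_sum h a l N = \sum_(j < N)
  ((h (a + rc (j%:R + 2^-1) * l)
    - h (a + rc N%:R * (ii * l) + rc (j%:R + 2^-1) * l)) * l
  + (h (a + rc N%:R * l + rc (j%:R + 2^-1) * (ii * l))
    - h (a + rc (j%:R + 2^-1) * (ii * l))) * (ii * l)).
Proof.
by rewrite /boundary_sum /edge_sum -big_split -!sumrB; apply: eq_bigr => j _ /=; ring.
Qed.

Lemma boundary_sumB h1 h2 a l N :
  boundary_sum (fun t => h1 t - h2 t) a l N
  = boundary_sum h1 a l N - boundary_sum h2 a l N.
Proof. by rewrite !boundary_sumE -sumrB; apply: eq_bigr => j _; ring. Qed.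

Lemma boundary_sumZ (c : C) h a l N :
  boundary_sum (fun t => c * h t) a l N = c * boundary_sum h a l N.
Proof. by rewrite !boundary_sumE mulr_sumr; apply: eq_bigr => j _; ring. Qed.

(** The cancellation is term by term: the horizontal pair of nodes gives [- b * N * ii * l ^ 2], the
    vertical pair the opposite. This is the discrete form of a vanishing contour integral. *)
Lemma boundary_sum_affine (c b : C) a l N :
  boundary_sum (fun t => c + b * t) a l N = 0.
Proof. by rewrite boundary_sumE big1 // => j _; ring. Qed.

Lemma boundary_points a s N (j : 'I_N) : 0 <= s ->
  [/\ cframe a (N%:R * s) (a + rc (j%:R + 2^-1) * rc s),
      cframe a (N%:R * s) (a + rc N%:R * (ii * rc s) + rc (j%:R + 2^-1) * rc s),
      cframe a (N%:R * s) (a + rc N%:R * rc s + rc (j%:R + 2^-1) * (ii * rc s)) &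
      cframe a (N%:R * s) (a + rc (j%:R + 2^-1) * (ii * rc s))].
Proof.
move=> s0; have jN : (j%:R + 1 : R) <= N%:R by rewrite natr1 ler_nat.
have j0 : 0 <= j%:R :> R by [].
have h1 : 0 <= (j%:R + 2^-1) * s by apply: mulr_ge0 => //; lra.
have h2 : (j%:R + 2^-1) * s <= N%:R * s by apply: ler_wpM2r => //; lra.
rewrite /cframe /csquare /=; split; rewrite ?(ReD, ImD, ReZ, ImZ) /=.
- by split; [split; lra | apply: Or43; lra].
- by split; [split; lra | apply: Or44; lra].
- by split; [split; lra | apply: Or42; lra].
- by split; [split; lra | apply: Or41; lra].
Qed.

Lemma boundary_sum_bound h a s N B : 0 <= s ->
  (forall t, cframe a (N%:R * s) t -> cabs (h t) <= B) ->
  cabs (boundary_sum h a (rc s) N) <= 4 * (N%:R * s) * B.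
Proof.
move=> s0 hB; rewrite boundary_sumE.
apply: le_trans (cabs_sum _ _ _) _.
apply: (@le_trans _ _ (\sum_(j < N) (4 * s * B))); last first.
  by rewrite sumr_const card_ord -mulr_natl; lra.
apply: ler_sum => j _.
have [/hB p1 /hB p2 /hB p3 /hB p4] := boundary_points a j s0.
have ii1 : cabs ii = 1 by rewrite /cabs /= expr0n expr1n add0r sqrtr1.
apply: le_trans (cabsD _ _) _; rewrite !cabsM cabs_real ii1 mul1r ger0_norm//.
rewrite -mulrDl mulrAC; apply: ler_wpM2r => //.
by apply: le_trans (lerD (cabsB _ _) (cabsB _ _)) _; lra.
Qed.

Lemma boundary_sum_near_affine h (c b : C) a s N B : 0 <= s ->
  (forall t, cframe a (N%:R * s) t -> cabs (h t - (c + b * t)) <= B) ->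
  cabs (boundary_sum h a (rc s) N) <= 4 * (N%:R * s) * B.
Proof.
move=> s0 hB; have := boundary_sum_bound s0 hB.
by rewrite boundary_sumB boundary_sum_affine subr0.
Qed.

(** * Dyadic contours, bisection and Goursat's argument *)

Definition contour h a L m : C := boundary_sum h a (rc (L / 2 ^+ m)) (2 ^ m).

Lemma pow2_cancel L m : (2 ^ m)%:R * (L / 2 ^+ m) = L.
Proof. by rewrite natrX mulrC divfK // expf_neq0. Qed.

Definition quadrant a L (i j : bool) : C :=
  a + rc (if i then L / 2 else 0) + rc (if j then L / 2 else 0) * ii.

(** Halving the side while lowering the level by one leaves the step [L / 2 ^+ m.+1] unchanged, so
    bisection is an exact identity and not only a limit. *)
Lemma contour_split h a L m : contour h a L m.+1 =
  contour h (quadrant a L false false) (L / 2) m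
  + contour h (quadrant a L true false) (L / 2) m
  + contour h (quadrant a L false true) (L / 2) m
  + contour h (quadrant a L true true) (L / 2) m.
Proof.
rewrite /contour expnS mul2n -addnn boundary_sum_split.
have -> : L / 2 ^+ m.+1 = L / 2 / 2 ^+ m.
  by rewrite exprS invfM mulrA.
rewrite /quadrant !rmorph0 !mul0r !addr0.
have E : rc (2 ^ m)%:R * rc (L / 2 / 2 ^+ m) = rc (L / 2).
  by rewrite -rmorphM pow2_cancel.
have E' : rc (2 ^ m)%:R * (ii * rc (L / 2 / 2 ^+ m)) = rc (L / 2) * ii.
  by rewrite mulrCA E mulrC.
by rewrite E E'.
Qed.

(* Sum of the indicators of the two half-open intervals with ends [u] and
   [u + L]: additive under bisection and at least 1 on the closed interval, so
   it charges a point like a Dirac mass even at subdivision points. *)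
Definition point_mass1 (x u L : R) : R := (u <= x < u + L)%R%:R + (u < x <= u + L)%R%:R.

Lemma point_mass1_split (x u L : R) : 0 < L ->
  point_mass1 x u L = point_mass1 x u (L / 2) + point_mass1 x (u + L / 2) (L / 2).
Proof.
move=> L0; rewrite /point_mass1.
have -> : u + L / 2 + L / 2 = u + L by lra.
have H1 : u < u + L / 2 by lra.
have H2 : u + L / 2 < u + L by lra.
move: (u + L / 2) (u + L) H1 H2 => v w H1 H2.
case: (ltgtP u x) => ux; case: (ltgtP x v) => xv; case: (ltgtP x w) => xw //=;
  rewrite ?addr0 ?add0r //; try lra.
all: try (exfalso; lra).
Qed.

Lemma point_mass1_ge0 (x u L : R) : 0 <= point_mass1 x u L.
Proof. by rewrite addr_ge0. Qed.

Lemma point_mass1_ge1 (x u L : R) : 0 < L -> u <= x <= u + L -> 1 <= point_mass1 x u L.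
Proof.
rewrite /point_mass1 => L0 /andP[h1 h2]; rewrite h1 h2 /= andbT.
case: (ltP x (u + L)) => h3 /=; first by rewrite lerDl.
by rewrite (_ : u < x) ?lerDr//; lra.
Qed.

Definition point_mass e a L : R :=
  point_mass1 (Re e) (Re a) L * point_mass1 (Im e) (Im a) L.

Lemma point_mass_ge0 e a L : 0 <= point_mass e a L.
Proof. by rewrite mulr_ge0 ?point_mass1_ge0. Qed.

Lemma point_mass_ge1 e a L : 0 < L -> csquare a L e -> 1 <= point_mass e a L.
Proof. by move=> L0 [h1 h2]; rewrite mulr_ege1 ?point_mass1_ge1. Qed.

Lemma Re_quadrant a L i j : Re (quadrant a L i j) = Re a + (if i then L / 2 else 0).
Proof. by rewrite /quadrant !ReD ReZ /= mulr0 addr0. Qed.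

Lemma Im_quadrant a L i j : Im (quadrant a L i j) = Im a + (if j then L / 2 else 0).
Proof. by rewrite /quadrant !ImD ImZ /= mulr1 addr0. Qed.

Lemma point_mass_split e a L : 0 < L -> point_mass e a L =
  point_mass e (quadrant a L false false) (L / 2)
  + point_mass e (quadrant a L true false) (L / 2)
  + point_mass e (quadrant a L false true) (L / 2)
  + point_mass e (quadrant a L true true) (L / 2).
Proof.
move=> L0; rewrite /point_mass !Re_quadrant !Im_quadrant !addr0.
by rewrite (point_mass1_split (Re e)) // (point_mass1_split (Im e)) //; ring.
Qed.

Lemma csquare_dist a L t t' : csquare a L t -> csquare a L t' -> cabs (t - t') <= 2 * L.
Proof.
move=> [h1 h2] [h3 h4]; apply: le_trans (cabs_le_ReIm _) _.
rewrite ReB ImB.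
have : `|Re t - Re t'| <= L by rewrite ler_norml; apply/andP; split; lra.
have : `|Im t - Im t'| <= L by rewrite ler_norml; apply/andP; split; lra.
lra.
Qed.

Lemma contour_bound h a L m B : 0 <= L ->
  (forall t, cframe a L t -> cabs (h t) <= B) ->
  cabs (contour h a L m) <= 4 * L * B.
Proof.
move=> L0 hB; have E := pow2_cancel L m.
rewrite -{2}E; apply: boundary_sum_bound; first by rewrite divr_ge0 ?exprn_ge0.
by rewrite E.
Qed.

Lemma contour_near_affine h (c b : C) a L m B : 0 <= L ->
  (forall t, cframe a L t -> cabs (h t - (c + b * t)) <= B) ->
  cabs (contour h a L m) <= 4 * L * B.
Proof.
move=> L0 hB; have E := pow2_cancel L m.
rewrite -{2}E; apply: (boundary_sum_near_affine (c := c) (b := b)).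
  by rewrite divr_ge0 ?exprn_ge0.
by rewrite E.
Qed.

(** In each coordinate, the midpoints of two nested intervals are no farther apart than the sum of
    the half-lengths. [real_limit], with the half-lengths as errors, then returns a point within
    half a length of every midpoint. *)
Lemma nested_squares (a : nat -> C) (L : nat -> R) :
  (forall k, 0 <= L k) ->
  (forall k, [/\ Re (a k) <= Re (a k.+1), Re (a k.+1) + L k.+1 <= Re (a k) + L k,
                 Im (a k) <= Im (a k.+1) & Im (a k.+1) + L k.+1 <= Im (a k) + L k]) ->
  exists t, forall k, csquare (a k) (L k) t.
Proof.
move=> L0 aL.
have key (u : nat -> R) : (forall k, u k <= u k.+1 /\ u k.+1 + L k.+1 <= u k + L k) ->
    exists x, forall k, u k <= x <= u k + L k.
  move=> hu.
  have mono k (l : nat) : (k <= l)%N -> u k <= u l /\ u l + L l <= u k + L k.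
    elim: l => [|l IH]; first by rewrite leqn0 => /eqP ->.
    rewrite leq_eqVlt => /predU1P[->//|/IH]; have := hu l; lra.
  have [k l|x hx] := @real_limit R (fun k => u k + L k / 2) (fun k => L k / 2).
    have [kl|/ltnW kl] := leqP k l; have := mono _ _ kl; have := L0 k; have := L0 l;
      rewrite ler_norml => ? ? ?; apply/andP; split; lra.
  by exists x => k; have := hx k; rewrite ler_norml => /andP[? ?]; lra.
have [|x hx] := key (fun k => Re (a k)); first by move=> k; have [] := aL k.
have [|y hy] := key (fun k => Im (a k)); first by move=> k; have [] := aL k.
by exists (Complex x y) => k; split.
Qed.

(** Goursat's bisection with the weight [wt], area plus point masses at the exceptional points [X].
    The weight is additive under bisection, so a square on which the bound [eta * wt] fails has a
    quarter on which it fails, and these quarters shrink to a point [t0]. Near [t0] the bound does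
    hold: either differentiability beats the area, or boundedness beats the point mass. *)
Lemma contour_cvg0 h (X : seq C) a L : 0 < L ->
  (forall t, csquare a L t -> t \notin X -> cdiff h t) ->
  (forall e, e \in X -> exists B, exists2 d : R, 0 < d &
     forall t, cabs (t - e) < d -> cabs (h t) <= B) ->
  forall eta, 0 < eta -> exists m0, forall m, (m0 <= m)%N -> cabs (contour h a L m) <= eta.
Proof.
move=> L0 hd hX eta0 eta00.
pose wt a L := L ^+ 2 + \sum_(e <- X) point_mass e a L.
have wt_split b M : 0 < M -> wt b M =
   wt (quadrant b M false false) (M / 2) + wt (quadrant b M true false) (M / 2)
   + wt (quadrant b M false true) (M / 2) + wt (quadrant b M true true) (M / 2).
  move=> M0; rewrite /wt; under eq_bigr do rewrite point_mass_split//.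
  by rewrite !big_split /=; lra.
have wt_ge0 b M : 0 <= wt b M.
  by rewrite addr_ge0 ?sqr_ge0// sumr_ge0 // => e _; exact: point_mass_ge0.
pose good eta b M :=
  exists m0, forall m, (m0 <= m)%N -> cabs (contour h b M m) <= eta * wt b M.
suff main eta : 0 < eta -> good eta a L.
  have w1 : 0 < wt a L + 1 by rewrite ltr_wpDl.
  have [|m0 hm] := main (eta0 / (wt a L + 1)); first by rewrite divr_gt0.
  exists m0 => m /hm /le_trans; apply.
  by rewrite mulrAC ler_pdivrMr // ler_wpM2l ?(ltW eta00) // lerDl.
move=> eta_gt0; apply: contrapT => nga.
(* The hypotheses on [p] stand under the existential, so that [choice] yields a total function that
   can be iterated. *)
have step (p : C * R) : exists q : C * R, 0 < p.2 -> ~ good eta p.1 p.2 ->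
    ~ good eta q.1 q.2 /\ exists i j, q = (quadrant p.1 p.2 i j, p.2 / 2).
  case: p => b M /=; apply: contrapT => /forallNP nq.
  have gq i j : good eta (quadrant b M i j) (M / 2).
    apply: contrapT => ng; apply: (nq (quadrant b M i j, M / 2)) => _ _.
    by split=> //; exists i, j.
  have [M0 [ngb _]] : 0 < M /\ (~ good eta b M /\ True).
    apply: contrapT => hn; apply: (nq (0, 0)) => M0 ngb; exfalso; apply: hn.
    by [].
  apply: ngb; have [m1 h1] := gq false false; have [m2 h2] := gq true false.
  have [m3 h3] := gq false true; have [m4 h4] := gq true true.
  (* Level [m.+1] on the square corresponds to level [m] on its quarters, hence the successor. *)
  exists (maxn (maxn m1 m2) (maxn m3 m4)).+1 => -[//|m].
  rewrite ltnS !geq_max => /andP[/andP[l1 l2] /andP[l3 l4]].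
  rewrite contour_split wt_split // 3!mulrDr.
  apply: le_trans (cabsD _ _) _; apply: lerD; last exact: h4.
  apply: le_trans (cabsD _ _) _; apply: lerD; last exact: h3.
  exact: le_trans (cabsD _ _) (lerD (h1 _ l1) (h2 _ l2)).
have [nxt hnxt] := choice step.
pose st k := iter k nxt (a, L).
have st_inv k : 0 < (st k).2 /\ ~ good eta (st k).1 (st k).2.
  elim: k => [//|k [IH1 IH2]]; rewrite /st iterS -/(st k).
  by have [ng [i [j E]]] := hnxt _ IH1 IH2; split=> //; rewrite E /= divr_gt0.
have st_nxt k : exists i j, st k.+1 = (quadrant (st k).1 (st k).2 i j, (st k).2 / 2).
  by have [s1 s2] := st_inv k; have [_] := hnxt _ s1 s2; rewrite /st iterS.
have st2 k : (st k).2 = L * 2^-1 ^+ k.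
  elim: k => [|k IH]; first by rewrite mulr1.
  by have [i [j ->]] := st_nxt k; rewrite /= IH exprSr mulrA.
have [||t0 ht0] := @nested_squares (fun k => (st k).1) (fun k => (st k).2).
- by move=> k; have [/ltW] := st_inv k.
- move=> k; have [i [j ->]] := st_nxt k; have [s1 _] := st_inv k.
  by rewrite /= Re_quadrant Im_quadrant; case: i; case: j; split; lra.
have small d : 0 < d -> exists k, (st k).2 < d.
  move=> d0; have [|k hk] := @exp2V_small R (d / L); first by rewrite divr_gt0.
  by exists k; rewrite st2 mulrC -ltr_pdivlMr // hk.
have bad k : (forall m, cabs (contour h (st k).1 (st k).2 m) <= eta * wt (st k).1 (st k).2) -> False.
  by have [_ ng] := st_inv k => hk; apply: ng; exists 0%N => m _; exact: hk.
(* At an exceptional point the contour sum is at most [4 * L * (|B| + 1)], which is below [eta] for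
   a small side [L], while the mass at [t0] makes the weight at least 1. *)
have [tX|tX] := boolP (t0 \in X).
  have [B [d d0 hB]] := hX _ tX.
  have [|k hk] := small (Num.min (d / 2) (eta / (4 * (`|B| + 1)))).
    by rewrite lt_min !divr_gt0 // mulr_gt0 // ltr_wpDl.
  move: hk; rewrite lt_min => /andP[k1 k2].
  have [s1 _] := st_inv k.
  apply: (bad k) => m; apply: le_trans (contour_bound (B := `|B| + 1) _ (ltW s1) _) _.
    move=> t [/csquare_dist /(_ (ht0 k)) tt _].
    apply: le_trans (hB _ _) _; first by lra.
    by apply: le_trans (ler_norm _) _; rewrite lerDl.
  have B1 : 0 < `|B| + 1 by rewrite ltr_wpDl.
  have : 4 * (st k).2 * (`|B| + 1) <= eta.
    by move: k2; rewrite ltr_pdivlMr ?mulr_gt0//; lra.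
  move/le_trans; apply; rewrite ler_peMr ?(ltW eta_gt0)//.
  rewrite /wt (big_rem t0) //=; have := point_mass_ge1 s1 (ht0 k).
  have := sqr_ge0 (st k).2.
  have : 0 <= \sum_(y <- rem t0 X) point_mass y (st k).1 (st k).2.
    by rewrite sumr_ge0 // => e _; exact: point_mass_ge0.
  lra.
(* At a regular point, subtracting the tangent at [t0] leaves at most [eta / 8 * (2 * L)] on the
   frame, and [4 * L] times this is [eta * L ^ 2]. *)
have [b hb] := hd _ (ht0 0%N) tX.
have [|d d0 hbd] := hb (eta / 8); first by rewrite divr_gt0.
have [|k hk] := small (d / 2); first by rewrite divr_gt0.
have [s1 _] := st_inv k.
apply: (bad k) => m.
apply: le_trans (contour_near_affine (B := eta / 8 * (2 * (st k).2)) (c := h t0 - b * t0) (b := b) _ (ltW s1) _) _.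
  move=> t [/csquare_dist /(_ (ht0 k)) tt _].
  have -> : h t - (h t0 - b * t0 + b * t) = h t - h t0 - b * (t - t0) by ring.
  apply: le_trans (hbd _ _) _; first by lra.
  by apply: ler_wpM2l tt; lra.
have : 0 <= \sum_(y <- X) point_mass y (st k).1 (st k).2.
  by rewrite sumr_ge0 // => e _; exact: point_mass_ge0.
rewrite /wt mulrDr => /(mulr_ge0 (ltW eta_gt0)); rewrite expr2; lra.
Qed.

(** * The Cauchy kernel and the Cauchy estimate *)

Lemma Im_boundary_sum h a (l : R) N : Im (boundary_sum h a (rc l) N) = \sum_(j < N)
  l * ((Im (h (a + rc (j%:R + 2^-1) * rc l))
    - Im (h (a + rc N%:R * (ii * rc l) + rc (j%:R + 2^-1) * rc l)))
  + (Re (h (a + rc N%:R * rc l + rc (j%:R + 2^-1) * (ii * rc l)))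
    - Re (h (a + rc (j%:R + 2^-1) * (ii * rc l))))).
Proof.
rewrite boundary_sumE (big_morph _ (@ImD R) (erefl (Im 0))).
apply: eq_bigr => j _; rewrite ImD.
rewrite [_ * rc l]mulrC ImZ ImB.
rewrite [X in _ + Im X](_ : _ = rc l * (ii * (h (a + rc N%:R * rc l + rc (j%:R + 2^-1) * (ii * rc l))
    - h (a + rc (j%:R + 2^-1) * (ii * rc l))))); last by ring.
rewrite ImZ -ReB -mulrDr; congr (l * (_ + _)).
by case: (_ - _) => x y /=; rewrite mul0r add0r mul1r.
Qed.

(* The four sides contribute nonnegatively to the [2 * pi] of Cauchy's formula;
   [16^-1] bounds the contribution of the right side alone. *)
Lemma contour_kernel_ge (s : R) z m : 0 < s -> cabs z <= s / 2 ->
  16^-1 <= Im (contour (fun t => (t - z)^-1) (Complex (- s) (- s)) (2 * s) m).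
Proof.
move=> s0 hz; rewrite /contour Im_boundary_sum.
have := pow2_cancel (2 * s) m; set l := _ / _; set N := (2 ^ m)%N => E.
have l0 : 0 < l by rewrite divr_gt0 ?exprn_gt0 ?mulr_gt0.
have hzR := le_trans (abs_Re_le z) hz; have hzI := le_trans (abs_Im_le z) hz.
move: hzR hzI; rewrite !ler_norml => /andP[zR1 zR2] /andP[zI1 zI2].
(* Since [N * l = 2 * s], contributions of [l / (32 * s)] per index add up to [16^-1]. *)
apply: (@le_trans _ _ (\sum_(j < N) l * (32 * s)^-1)).
  rewrite sumr_const card_ord -(mulr_natl _ N) mulrA E.
  by rewrite le_eqVlt; apply/orP; left; apply/eqP; field; rewrite gt_eqF.
apply: ler_sum => j _; rewrite ler_pM2l //.
have jN : (j%:R + 1 : R) <= N%:R by rewrite natr1 ler_nat.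
have j0 : 0 <= j%:R :> R by [].
have h1 : 0 <= (j%:R + 2^-1) * l by apply: mulr_ge0; lra.
have h2 : (j%:R + 2^-1) * l <= N%:R * l by apply: ler_wpM2r; lra.
have sgnI t : Im t <= Im z -> 0 <= Im (t - z)^-1.
  by move=> ht; rewrite Im_inv ImB divr_ge0 ?sqr_ge0//; lra.
have sgnI' t : Im z <= Im t -> Im (t - z)^-1 <= 0.
  move=> ht; rewrite Im_inv ImB mulNr oppr_le0 divr_ge0 ?sqr_ge0//; lra.
have sgnR t : Re t <= Re z -> Re (t - z)^-1 <= 0.
  move=> ht; rewrite Re_inv ReB -oppr_ge0 -mulNr divr_ge0 ?sqr_ge0//; lra.
have p1 := sgnI (Complex (- s) (- s) + rc (j%:R + 2^-1) * rc l).
have p2 := sgnI' (Complex (- s) (- s) + rc N%:R * (ii * rc l) + rc (j%:R + 2^-1) * rc l).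
have p4 := sgnR (Complex (- s) (- s) + rc (j%:R + 2^-1) * (ii * rc l)).
have {}p1 : 0 <= Im (Complex (- s) (- s) + rc (j%:R + 2^-1) * rc l - z)^-1.
  by apply: p1; rewrite !ImD !ImZ /=; lra.
have {}p2 : Im (Complex (- s) (- s) + rc N%:R * (ii * rc l) + rc (j%:R + 2^-1) * rc l - z)^-1 <= 0.
  by apply: p2; rewrite !ImD !ImZ /=; lra.
have {}p4 : Re (Complex (- s) (- s) + rc (j%:R + 2^-1) * (ii * rc l) - z)^-1 <= 0.
  by apply: p4; rewrite !ReD !ReZ /=; lra.
(* The constant is [(s / 2) / (4 * s) ^ 2]: on the right side [Re (t - z) >= s / 2] and
   [|t - z| <= 4 * s]. *)
suff : (32 * s)^-1 <= Re (Complex (- s) (- s) + rc N%:R * rc l + rc (j%:R + 2^-1) * (ii * rc l) - z)^-1.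
  lra.
set t := (X in (X - z)^-1).
have tR : Re t = s by rewrite /t !ReD !ReZ /=; lra.
have tI : - s <= Im t <= s by rewrite /t !ImD !ImZ /=; lra.
have pos : 0 < Re (t - z) by rewrite ReB; lra.
have t0 : 0 < cabs (t - z) by apply: lt_le_trans (abs_Re_le _); rewrite gtr0_norm.
have t4 : cabs (t - z) <= 4 * s.
  apply: le_trans (cabs_le_ReIm _) _.
  have : `|Re (t - z)| <= 2 * s by rewrite ReB ler_norml; lra.
  have : `|Im (t - z)| <= 2 * s by rewrite ImB ler_norml; lra.
  lra.
rewrite Re_inv ler_pdivlMr ?exprn_gt0// mulrC ler_pdivrMr ?mulr_gt0// ReB tR.
apply: (@le_trans _ _ ((4 * s) ^+ 2)); last first.
  have hs : s / 2 <= s - Re z by lra.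
  by have := ler_wpM2l (ltW s0) hs; rewrite expr2; lra.
by rewrite ler_sqr ?nnegrE ?(ltW t0)// mulr_ge0 ?ltW.
Qed.

Lemma cdiff_quotient u (k : C) t e : cdiff u t -> t != e ->
  cdiff (fun t => (u t - k) / (t - e)) t.
Proof.
move=> [b hb] te; set U := u t - k; set dl := t - e.
have dl0 : dl != 0 by rewrite subr_eq0.
have D0 := cabs_gt0 dl0.
exists (b / dl - U / dl ^+ 2) => eps eps0.
have [|d d0 hd] := hb (eps * cabs dl / 4); first by rewrite !(mulr_gt0, divr_gt0).
set K := cabs b / cabs dl + cabs U / cabs dl ^+ 2.
have K0 : 0 <= K by rewrite addr_ge0 ?divr_ge0 ?exprn_ge0 ?cabs_ge0.
(* The three radii control, in this order, the remainder of [u], the distance from [t'] to the pole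
   [e], and the quadratic term with coefficient at most [K]. Remainder and quadratic term each get
   [eps * |dl| / 4], and [|dl| / 2 <= |t' - e|]. *)
exists (Num.min (Num.min d (cabs dl / 2)) (eps * cabs dl / (4 * (K + 1)))).
  have K1 : 0 < K + 1 by rewrite ltr_wpDl.
  by rewrite !lt_min d0 /= !divr_gt0 // !mulr_gt0.
move=> t'; rewrite !lt_min => /andP[/andP[/hd hr h2] h3].
set r := u t' - u t - b * (t' - t) in hr.
have dh : dl + (t' - t) = t' - e by rewrite /dl; ring.
have D1 : cabs dl / 2 <= cabs (t' - e).
  have := cabs_le_add dl (t' - e).
  have -> : dl - (t' - e) = - (t' - t) by rewrite -dh; ring.
  by rewrite cabsN; lra.
have D2 : 0 < cabs (t' - e) by apply: lt_le_trans D1; rewrite divr_gt0.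
have te' : t' - e != 0.
  by apply/eqP => E; move: D2; rewrite E cabs0 ltxx.
have -> : (u t' - k) / (t' - e) - U / dl - (b / dl - U / dl ^+ 2) * (t' - t) =
  (r + (U / dl ^+ 2 - b / dl) * (t' - t) ^+ 2) / (t' - e).
  have -> : u t' - k = U + r + b * (t' - t) by rewrite /r /U; ring.
  rewrite -dh; field; rewrite dh; exact/andP.
rewrite cabsM cabsV ler_pdivrMr //.
apply: le_trans (cabsD _ _) _; rewrite expr2 !cabsM.
set H := cabs (t' - t) in hr h2 h3 *.
have H0 : 0 <= H by exact: cabs_ge0.
have hK : cabs (U / dl ^+ 2 - b / dl) <= K.
  apply: le_trans (cabsB _ _) _.
  by rewrite !cabsM !cabsV expr2 cabsM -expr2 addrC.
have h4 : K * H <= eps * cabs dl / 4.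
  move: h3; rewrite ltr_pdivlMr ?mulr_gt0 ?ltr_wpDl// => h3; lra.
have h5 : cabs (U / dl ^+ 2 - b / dl) * (H * H) <= K * H * H.
  by rewrite -mulrA ler_wpM2r ?mulr_ge0.
have h6 : K * H * H <= eps * cabs dl / 4 * H by rewrite ler_wpM2r.
have h7 : eps * H * (cabs dl / 2) <= eps * H * cabs (t' - e).
  by rewrite ler_wpM2l // mulr_ge0 // ltW.
lra.
Qed.

Lemma quotient_bounded u e : cdiff u e -> exists B, exists2 d : R, 0 < d &
  forall t, cabs (t - e) < d -> cabs ((u t - u e) / (t - e)) <= B.
Proof.
move=> [b hb]; have [//|d d0 hd] := hb 1; exists (cabs b + 1), d => // t /hd.
have [->|te] := eqVneq t e.
  by rewrite !subrr mul0r cabs0 => _; rewrite addr_ge0 ?cabs_ge0.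
have D : 0 < cabs (t - e) by rewrite cabs_gt0 // subr_eq0.
rewrite cabsM cabsV ler_pdivrMr // => h.
have := cabs_le_add (u t - u e) (b * (t - e)); rewrite cabsM; lra.
Qed.

(** Discrete Cauchy formula. The difference quotient [h] at [z] has contour sums tending to 0, with
    [z] as one more exceptional point. Hence [u z] times the contour sum of the kernel is nearly the
    contour sum of [u t / (t - z)], which is at most [16 * B]. The kernel contributes at least
    [16^-1], whence 256. The list [X] leaves room for removable singularities. *)
Lemma cauchy_bound u (X : seq C) (s B : R) z : 0 < s -> cabs z <= s / 2 -> z \notin X ->
  (forall t, cabs t <= 2 * s -> t \notin X -> cdiff u t) ->
  (forall e, e \in X -> exists B, exists2 d : R, 0 < d &
     forall t, cabs (t - e) < d -> cabs (u t) <= B) ->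
  (forall t, s <= cabs t <= 2 * s -> cabs (u t) <= B) ->
  cabs (u z) <= 256 * B.
Proof.
move=> s0 zs zX hd hX hB; apply/ler_addgt0Pr => eps eps0.
pose h t := (u t - u z) / (t - z); pose a : C := Complex (- s) (- s).
have sq_le t : csquare a (2 * s) t -> cabs t <= 2 * s.
  move=> [h1 h2]; apply: le_trans (cabs_le_ReIm _) _; move: h1 h2 => /=.
  have : `|Re t| <= s -> `|Im t| <= s -> `|Re t| + `|Im t| <= 2 * s by lra.
  by rewrite !ler_norml => H ? ?; apply: H; lra.
have fr_ge t : cframe a (2 * s) t -> s <= cabs t.
  move=> [_] /= [] E.
  - by apply: le_trans (abs_Re_le t); rewrite E normrN gtr0_norm.
  - by apply: le_trans (abs_Re_le t); rewrite E gtr0_norm; lra.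
  - by apply: le_trans (abs_Im_le t); rewrite E normrN gtr0_norm.
  - by apply: le_trans (abs_Im_le t); rewrite E gtr0_norm; lra.
have [||||m0 /(_ _ (leqnn _)) hm] := @contour_cvg0 h (z :: X) a (2 * s) _ _ _ (eps / 16).
- by rewrite mulr_gt0.
- move=> t /sq_le ts; rewrite inE negb_or => /andP[tz tX].
  exact: cdiff_quotient (hd _ ts tX) tz.
- move=> e; rewrite inE => /predU1P[->|eX].
    by apply: quotient_bounded; apply: hd => //; lra.
  have [B' [d d0 hB']] := hX _ eX.
  have ez : 0 < cabs (e - z).
    by rewrite cabs_gt0 // subr_eq0; apply: contraNneq zX => <-.
  exists ((B' + cabs (u z)) / (cabs (e - z) / 2)), (Num.min d (cabs (e - z) / 2)).
    by rewrite lt_min d0 divr_gt0.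
  move=> t; rewrite lt_min => /andP[/hB' h1 h2].
  have D : cabs (e - z) / 2 <= cabs (t - z).
    have := cabs_le_add (e - z) (t - z).
    have -> : e - z - (t - z) = - (t - e) by ring.
    rewrite cabsN; lra.
  have ez2 : 0 < cabs (e - z) / 2 by rewrite divr_gt0.
  rewrite /h cabsM cabsV; apply: ler_pM; rewrite ?invr_ge0 ?cabs_ge0 //.
    by apply: le_trans (cabsB _ _) _; rewrite lerD2r.
  by rewrite lef_pV2 ?posrE //; apply: lt_le_trans D.
- by rewrite divr_gt0.
set kk := contour (fun t => (t - z)^-1) a (2 * s) m0.
have kk_ge : 16^-1 <= cabs kk.
  apply: le_trans (contour_kernel_ge m0 s0 zs) _.
  exact: le_trans (ler_norm _) (abs_Im_le _).
have E : u z * kk = contour (fun t => u t / (t - z)) a (2 * s) m0 - contour h a (2 * s) m0.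
  rewrite /contour /kk -boundary_sumB -boundary_sumZ; congr boundary_sum.
  by apply/funext => t; rewrite /h; ring.
have hc : cabs (contour (fun t => u t / (t - z)) a (2 * s) m0) <= 4 * (2 * s) * (B / (s / 2)).
  apply: contour_bound; first by rewrite mulr_ge0 ?ltW.
  move=> t tf; have h1 := fr_ge _ tf; have h2 := sq_le _ tf.1.
  have h3 : s / 2 <= cabs (t - z) by have := cabs_le_add t z; lra.
  have s2 : 0 < s / 2 by rewrite divr_gt0.
  rewrite cabsM cabsV; apply: ler_pM; rewrite ?invr_ge0 ?cabs_ge0 //.
    by apply: hB; rewrite h1 h2.
  by rewrite lef_pV2 ?posrE //; apply: lt_le_trans h3.
have E2 : 4 * (2 * s) * (B / (s / 2)) = 16 * B by field; rewrite gt_eqF.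
have := congr1 (@cabs R) E; rewrite cabsM => E'.
have : cabs (u z) * 16^-1 <= cabs (u z) * cabs kk by rewrite ler_wpM2l // cabs_ge0.
have := cabsB (contour (fun t => u t / (t - z)) a (2 * s) m0) (contour h a (2 * s) m0).
rewrite -E'; lra.
Qed.

(** [cauchy_bound] applied to the difference quotient of [g] at 0, with 0 as exceptional point. On
    the annulus the quotient is at most [2 * M / s]. *)
Lemma holomorphic_disc_lipschitz g (s M : R) z : 0 < s -> cabs z <= s / 2 ->
  (forall t, cabs t <= 2 * s -> cdiff g t /\ cabs (g t) <= M) ->
  cabs (g z - g 0) <= 512 * M / s * cabs z.
Proof.
move=> s0 zs hg.
have [->|z0] := eqVneq z 0; first by rewrite subrr cabs0 mulr0.
pose u t := (g t - g 0) / (t - 0).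
have c0 : cabs (0 : C) <= 2 * s by rewrite cabs0 mulr_ge0 // ltW.
have : cabs (u z) <= 256 * (2 * M / s).
  apply: (@cauchy_bound u [:: 0] s) => //; first by rewrite inE.
  - by move=> t ts; rewrite inE => t0; apply: cdiff_quotient => //; have [] := hg _ ts.
  - by move=> e; rewrite inE => /eqP ->; apply: quotient_bounded; have [] := hg _ c0.
  move=> t /andP[t1 t2]; rewrite /u subr0 cabsM cabsV.
  apply: ler_pM; rewrite ?invr_ge0 ?cabs_ge0 //.
    have [_ ?] := hg _ t2; have [_ ?] := hg _ c0.
    by apply: le_trans (cabsB _ _) _; lra.
  by rewrite lef_pV2 ?posrE //; apply: lt_le_trans t1.
rewrite /u subr0 cabsM cabsV ler_pdivrMr ?cabs_gt0 //; lra.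
Qed.

End Goursat.

(** * Holomorphic functions of several variables *)

Section SeveralVariables.
Variables (R : realType) (n : nat).
Notation C := R[i].
Notation rc := (real_complex R).
Notation Cn := (Cn R n).
Implicit Types (z w : Cn) (f g : Cn -> C) (O : set Cn) (r e M : R).

Lemma cdist_ge0 z w : 0 <= cdist z w.
Proof. by rewrite /cdist; elim/big_rec: _ => // j x _ x0; rewrite le_max x0 orbT. Qed.

Lemma cabs_le_cdist z w j : cabs (z j - w j) <= cdist z w.
Proof. exact: (le_bigmax _ (fun j => cabs (z j - w j))). Qed.

Lemma cdist_le z w r : 0 <= r -> (forall j, cabs (z j - w j) <= r) -> cdist z w <= r.
Proof. by move=> r0 h; apply: bigmax_le => // j _. Qed.

Lemma cdist_refl z : cdist z z = 0.
Proof.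
by apply/le_anti; rewrite cdist_ge0 andbT cdist_le // => j; rewrite subrr cabs0.
Qed.

Lemma cdistC z w : cdist z w = cdist w z.
Proof. by apply: eq_bigr => j _; rewrite cabsC. Qed.

Lemma cdist_triangle (v z w : Cn) : cdist z w <= cdist z v + cdist v w.
Proof.
apply: cdist_le => [|j]; first by rewrite addr_ge0 ?cdist_ge0.
have -> : z j - w j = (z j - v j) + (v j - w j) by ring.
by apply: le_trans (cabsD _ _) _; rewrite lerD ?cabs_le_cdist.
Qed.

Lemma cdist0_eq z w : cdist z w = 0 -> z = w.
Proof.
move=> h; apply/funext => j; apply/eqP; rewrite -subr_eq0; apply/eqP/cabs0_eq0.
by apply/le_anti; rewrite cabs_ge0 andbT -h cabs_le_cdist.
Qed.

(** The condition inside [holomorphic_on] with the gradient as a parameter, so that gradients of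
    different functions can be compared. *)
Definition cgrad f z (a : 'I_n -> C) := forall e, 0 < e -> exists2 d : R, 0 < d &
  forall w, cdist w z < d ->
    cabs (f w - f z - \sum_(j < n) a j * (w j - z j)) <= e * cdist w z.

Lemma cgradB f g z a b : cgrad f z a -> cgrad g z b ->
  cgrad (fun w => f w - g w) z (fun j => a j - b j).
Proof.
move=> ha hb e e0; have e2 : 0 < e / 2 by rewrite divr_gt0.
have [d1 d10 h1] := ha _ e2; have [d2 d20 h2] := hb _ e2.
exists (Num.min d1 d2) => [|w]; first by rewrite lt_min d10 d20.
rewrite lt_min => /andP[/h1 {}h1 /h2 {}h2].
have -> : \sum_(j < n) (a j - b j) * (w j - z j) =
    \sum_(j < n) a j * (w j - z j) - \sum_(j < n) b j * (w j - z j).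
  by rewrite -sumrB; apply: eq_bigr => j _; rewrite mulrBl.
set A := \sum_(j < n) _ in h1 *; set B := \sum_(j < n) _ in h2 *.
have -> : f w - g w - (f z - g z) - (A - B) = (f w - f z - A) - (g w - g z - B) by ring.
by apply: le_trans (cabsB _ _) _; lra.
Qed.

Lemma holomorphicB O f g : holomorphic_on O f -> holomorphic_on O g ->
  holomorphic_on O (fun w => f w - g w).
Proof.
by move=> hf hg z Oz; have [a ha] := hf _ Oz; have [b hb] := hg _ Oz;
  exists (fun j => a j - b j); exact: cgradB.
Qed.

Lemma cabs_linear_le (a : 'I_n -> C) (K : R) z w : (forall j, cabs (a j) <= K) ->
  cabs (\sum_(j < n) a j * (w j - z j)) <= n%:R * K * cdist w z.
Proof.
move=> hK; apply: le_trans (cabs_sum _ _ _) _.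
apply: (@le_trans _ _ (\sum_(j < n) K * cdist w z)).
  by apply: ler_sum => j _; rewrite cabsM ler_pM ?cabs_ge0 ?cabs_le_cdist.
by rewrite sumr_const card_ord -mulrA mulr_natl.
Qed.

Lemma holomorphic_continuous O f z : holomorphic_on O f -> O z ->
  forall e, 0 < e -> exists2 d, 0 < d & forall w, cdist w z < d -> cabs (f w - f z) < e.
Proof.
move=> hf /hf [a ha] e e0; have [//|d d0 hd] := ha 1.
pose K := \sum_(j < n) cabs (a j).
have aK j : cabs (a j) <= K.
  by rewrite /K (bigD1 j) //= lerDl sumr_ge0 // => *; exact: cabs_ge0.
have K0 : 0 <= K by rewrite sumr_ge0 // => *; exact: cabs_ge0.
have K1 : 0 < 1 + n%:R * K by rewrite ltr_pwDl // mulr_ge0.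
exists (Num.min d (e / (1 + n%:R * K))) => [|w].
  by rewrite lt_min d0 divr_gt0.
rewrite lt_min ltr_pdivlMr // => /andP[/hd h1 h2].
have h3 := cabs_linear_le z w aK.
apply: le_lt_trans h2; rewrite mulrC mulrDl.
by apply: le_trans (cabs_le_add _ (\sum_(j < n) a j * (w j - z j))) _; lra.
Qed.

Lemma holomorphic_line O f z (v : 'I_n -> C) t :
  holomorphic_on O f -> (forall j, cabs (v j) <= 1) ->
  O (fun j => z j + t * v j) -> cdiff (fun s => f (fun j => z j + s * v j)) t.
Proof.
move=> hf hv /hf [a ha]; exists (\sum_(j < n) a j * v j) => e e0.
have [d d0 hd] := ha _ e0; exists d => // t' tt'.
have D : cdist (fun j => z j + t' * v j : C) (fun j => z j + t * v j) <= cabs (t' - t).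
  apply: cdist_le => [|j]; first exact: cabs_ge0.
  have -> : z j + t' * v j - (z j + t * v j) = (t' - t) * v j by ring.
  by rewrite cabsM ler_piMr ?cabs_ge0.
have := hd _ (le_lt_trans D tt').
have -> : \sum_(j < n) a j * (z j + t' * v j - (z j + t * v j)) =
  (\sum_(j < n) a j * v j) * (t' - t).
  by rewrite mulr_suml; apply: eq_bigr => j _; ring.
by move/le_trans; apply; rewrite ler_wpM2l // ltW.
Qed.

(** Restriction to the complex line through [z] and [w], whose direction [v] is normalised in the
    sup norm so that [w] has parameter [d]. The one-variable estimate with [s = r / 4] gives
    [512 / (r / 4) = 2048 / r]. *)
Lemma holomorphic_lipschitz O f z r M w : holomorphic_on O f -> 0 < r ->
  (forall w, cdist w z < r -> O w /\ cabs (f w) <= M) ->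
  cdist w z <= r / 8 -> cabs (f w - f z) <= 2048 * M / r * cdist w z.
Proof.
move=> hf r0 hO; set d := cdist w z => wz.
have [d0|d0] := eqVneq d 0.
  by rewrite (cdist0_eq d0) subrr cabs0 d0 mulr0.
have dp : 0 < d by rewrite lt_neqAle eq_sym d0 cdist_ge0.
pose v j : C := (w j - z j) / rc d.
have cd : cabs (rc d) = d by rewrite cabs_real gtr0_norm.
have v1 j : cabs (v j) <= 1.
  by rewrite cabsM cabsV cd ler_pdivrMr // mul1r cabs_le_cdist.
pose g t := f (fun j => z j + t * v j).
have E : w = (fun j => z j + rc d * v j).
  apply/funext => j; rewrite /v mulrCA divff ?mulr1 ?(addrC (z j)) ?subrK//.
  by apply/eqP => E0; move: dp; rewrite -cd E0 cabs0 ltxx.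
have E0 : z = (fun j => z j + 0 * v j) by apply/funext => j; rewrite mul0r addr0.
have := @holomorphic_disc_lipschitz R g (r / 4) M (rc d).
rewrite /g -E -E0 cd; set T := (X in _ -> _ -> _ -> X) => H.
have -> : 2048 * M / r * d = 512 * M / (r / 4) * d by field; rewrite gt_eqF.
apply: H; [by rewrite divr_gt0 | by lra |] => t ts.
have tr : cdist (fun j => z j + t * v j : C) z < r.
  apply: le_lt_trans (_ : cabs t < r); last by lra.
  apply: cdist_le => [|j]; first exact: cabs_ge0.
  by rewrite addrAC subrr add0r cabsM ler_piMr ?cabs_ge0.
have [h1 h2] := hO _ tr; split=> //; exact: holomorphic_line hf v1 h1.
Qed.

(** A small real displacement [h] of the coordinate [j] alone reduces the linear term to
    [a j * h]. *)
Lemma cgrad_bound f z a (K r : R) j : 0 < r -> cgrad f z a ->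
  (forall w, cdist w z <= r -> cabs (f w - f z) <= K * cdist w z) -> cabs (a j) <= K.
Proof.
move=> r0 ha hK; apply/ler_addgt0Pr => e e0; have [d d0 hd] := ha _ e0.
pose h := Num.min r (d / 2); have h0 : 0 < h by rewrite lt_min r0 divr_gt0.
pose w i : C := z i + (if i == j then rc h else 0).
have ch : cabs (rc h) = h by rewrite cabs_real gtr0_norm.
have D : cdist w z = h.
  apply/le_anti/andP; split.
    apply: cdist_le => [|i]; first exact: ltW.
    by rewrite /w addrAC subrr add0r; case: ifP; rewrite ?ch ?cabs0 // ltW.
  by have := cabs_le_cdist w z j; rewrite /w eqxx addrAC subrr add0r ch.
have gradw : \sum_(i < n) a i * (w i - z i) = a j * rc h.
  rewrite (bigD1 j) //= big1 ?addr0 /w ?eqxx; first by rewrite addrAC subrr add0r.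
  by move=> i /negbTE ->; rewrite addr0 subrr mulr0.
have hd2 : h < d by apply: (@le_lt_trans _ _ (d / 2)); [rewrite ge_min lexx orbT | lra].
have := hd w; rewrite D gradw => /(_ hd2) h1.
have := hK w; rewrite D ge_min lexx => /(_ isT) h2.
have h3 : cabs (a j * rc h) <= (K + e) * h.
  apply: le_trans (cabs_le_add _ (f w - f z)) _; rewrite [X in _ + X]cabsC; lra.
by move: h3; rewrite cabsM ch ler_pM2r.
Qed.

(** Weierstrass' theorem without Cauchy integrals. The Lipschitz estimate for the differences
    [v i - v l] serves twice: it makes the gradients a Cauchy sequence, and it bounds the increments
    of [v i - v l] by a small multiple of [cdist w z], which survives the passage to [f]. *)
Lemma holomorphic_limit O (u : nat -> Cn -> C) f :
  (forall k, holomorphic_on O (u k)) ->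
  (forall z, O z -> exists2 r, 0 < r & (forall w, cdist w z < r -> O w) /\
     forall e, 0 < e -> exists k, forall w, cdist w z < r -> cabs (u k w - f w) <= e) ->
  holomorphic_on O f.
Proof.
move=> hu hlim z Oz; have [r r0 [rO hr]] := hlim _ Oz.
pose eps (i : nat) : R := 2^-1 ^+ i.
have eps0 i : 0 < eps i by rewrite exprn_gt0.
have [K hK] : exists K : nat -> nat, forall i w, cdist w z < r -> cabs (u (K i) w - f w) <= eps i.
  by have [K hK] := choice (fun i => hr (eps i) (eps0 i)); exists K.
pose v i := u (K i).
have [a ha] : exists a : nat -> 'I_n -> C, forall i, cgrad (v i) z (a i).
  by have [a ha] := choice (fun i => hu (K i) z Oz); exists a.
have [Lam LamE Lam0] : exists2 Lam, Lam = 2048 / r & 0 < Lam.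
  by exists (2048 / r); [reflexivity | apply: divr_gt0; [rewrite ltr0n | exact: r0]].
have r8 : 0 < r / 8 by rewrite divr_gt0.
have lip i l w : cdist w z <= r / 8 ->
    cabs ((v i w - v l w) - (v i z - v l z)) <= (Lam * eps i + Lam * eps l) * cdist w z.
  move=> wr; have -> : (Lam * eps i + Lam * eps l) = 2048 * (eps i + eps l) / r by rewrite LamE; lra.
  apply: (@holomorphic_lipschitz O (fun w => v i w - v l w)) => //.
    by apply: holomorphicB; exact: hu.
  move=> x xr; split; first exact: rO.
  have -> : v i x - v l x = (v i x - f x) - (v l x - f x) by ring.
  by apply: le_trans (cabsB _ _) _; rewrite lerD ?hK.
have grd i l j : cabs (a i j - a l j) <= Lam * eps i + Lam * eps l.
  exact: (cgrad_bound j r8 (cgradB (ha i) (ha l)) (lip i l)).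
have [b hb] : exists b : 'I_n -> C, forall j i, cabs (a i j - b j) <= 2 * (Lam * eps i).
  have /choice[b hb] : forall j, exists x, forall i, cabs (a i j - x) <= 2 * (Lam * eps i).
    by move=> j; apply: complex_limit => i l; exact: grd.
  by exists b.
(* [Q] collects the errors in units of [eps i * cdist w z]: [2 * Lam] from replacing [v i] by [v l],
   [2 * n * Lam] from replacing the gradient by [b], and [Lam] from replacing [v l] by [f] at two
   points. *)
exists b => e e0; pose Q := (3 + n%:R * 2) * Lam.
have Q0 : 0 < Q by rewrite mulr_gt0 // ltr_pwDl // mulr_ge0.
have [|i /(_ _ (leqnn _)) hi] := @exp2V_small R (e / 2 / Q); first by rewrite !divr_gt0.
have [|d d0 hd] := ha i (e / 2); first by rewrite divr_gt0.
exists (Num.min d (r / 8)) => [|w]; first by rewrite lt_min d0.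
rewrite lt_min => /andP[/hd h1 wr].
have [w0|w0] := eqVneq (cdist w z) 0.
  rewrite (cdist0_eq w0) cdist_refl mulr0 subrr sub0r cabsN big1 ?cabs0// => j _.
  by rewrite subrr mulr0.
have wp : 0 < cdist w z by rewrite lt_neqAle eq_sym w0 cdist_ge0.
(* The index [l] may depend on [w], since it occurs in no radius; this makes [|v l - f|] small
   compared with [cdist w z]. *)
have [|l0 hl] := @exp2V_small R (Lam * eps i * cdist w z / 2).
  by rewrite divr_gt0 // !mulr_gt0 // eps0.
pose l := maxn i l0; have {}hl := hl l (leq_maxr _ _).
have il : eps l <= eps i by apply: ler_wiXn2l; [lra|lra|exact: leq_maxl].
have h2 := lip i l w (ltW wr).
have h3 : cabs (v l w - f w) <= eps l by apply: hK; lra.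
have h4 : cabs (v l z - f z) <= eps l by apply: hK; rewrite cdist_refl.
have h5 : cabs (\sum_(j < n) (a i j - b j) * (w j - z j)) <= n%:R * (2 * (Lam * eps i)) * cdist w z.
  by apply: cabs_linear_le => j; exact: hb.
have E : \sum_(j < n) (a i j - b j) * (w j - z j) =
    \sum_(j < n) a i j * (w j - z j) - \sum_(j < n) b j * (w j - z j).
  by rewrite -sumrB; apply: eq_bigr => j _; rewrite mulrBl.
rewrite E in h5.
set A := \sum_(j < n) a i j * _ in h1 h5; set B := \sum_(j < n) b j * _ in h5 *.
have -> : f w - f z - B = (v i w - v i z - A) + (A - B)
   - ((v i w - v l w) - (v i z - v l z)) - (v l w - f w) + (v l z - f z) by ring.
have h6 : (3 + n%:R * 2) * Lam * eps i * cdist w z <= e / 2 * cdist w z.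
  rewrite ler_pM2r // -/Q mulrC -ler_pdivlMr //; exact: ltW.
have h7 : Lam * eps l * cdist w z <= Lam * eps i * cdist w z.
  by rewrite ler_pM2r // ler_pM2l.
apply: le_trans (cabsD _ _) _.
have := cabsB ((v i w - v i z - A) + (A - B) - ((v i w - v l w) - (v i z - v l z))) (v l w - f w).
have := cabsB ((v i w - v i z - A) + (A - B)) ((v i w - v l w) - (v i z - v l z)).
have := cabsD (v i w - v i z - A) (A - B).
rewrite /eps in hl il h2 h3 h4 h5 h6 h7 *; lra.
Qed.

Lemma cn_limit (u : nat -> Cn) (eps : nat -> R) :
  (forall k, 0 <= eps k) ->
  (forall k l, cdist (u k) (u l) <= eps k + eps l) ->
  exists x : Cn, forall k, cdist (u k) x <= 2 * eps k.
Proof.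
move=> e0 h.
have /choice[x hx] : forall j, exists t, forall k, cabs (u k j - t) <= 2 * eps k.
  move=> j; apply: (@complex_limit R (fun k => u k j)) => k l.
  exact: le_trans (cabs_le_cdist _ _ _) (h k l).
by exists x => k; apply: cdist_le => [|j]; rewrite ?mulr_ge0 ?hx.
Qed.

End SeveralVariables.

(** * Integrals of powers of holomorphic functions *)

Section IntPow.
Variables (R : realType) (n : nat) (mu : {measure set (CnB R n) -> \bar R}).
Notation C := R[i].
Notation Cn := (Cn R n).
Notation CnB := (CnB R n).
Notation Re := complex.Re.
Notation Im := complex.Im.
Implicit Types (z w : Cn) (f g : Cn -> C) (O : set Cn) (A B : set CnB) (p r e M : R).

Lemma Cn_open_measurable O : Cn_open O -> measurable (O : set CnB).
Proof. by move=> oO; exact: sub_sigma_algebra. Qed.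

(** By continuity of [f], the part of [O] where [|f|] exceeds a given value is open, hence Borel. *)
Lemma measurable_cabs_pow O f A r : Cn_open O -> holomorphic_on O f ->
  measurable A -> A `<=` O ->
  measurable_fun A (fun z : CnB => (cabs (f z) `^ r)%:E).
Proof.
move=> oO hf mA AO; apply: (measurable_funS (Cn_open_measurable oO)) => //.
apply/measurable_EFinP.
apply: (measurableT_comp (measurable_powR r)).
move=> mO; apply: (measurability _ (RGenOInfty.measurableE R)) => //.
move=> _ [_ [x ->] <-]; apply: Cn_open_measurable => z [Oz /=].
rewrite in_itv /= andbT => xf.
have [d d0 hd] := oO _ Oz.
have [|d' d'0 hd'] := holomorphic_continuous hf Oz (e := cabs (f z) - x); first by rewrite subr_gt0.
exists (Num.min d d') => [|w]; first by rewrite lt_min d0.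
rewrite lt_min => /andP[/hd Ow /hd' fw]; split=> //=; rewrite in_itv /= andbT.
have := cabs_le_add (f z) (f w); rewrite cabsC; lra.
Qed.

Lemma int_pow_ge0 A r f : (0 <= int_pow mu A r f)%E.
Proof. by apply: integral_ge0 => z _; rewrite lee_fin powR_ge0. Qed.

Lemma int_pow_subset O f A B r : Cn_open O -> holomorphic_on O f ->
  measurable A -> measurable B -> A `<=` B -> B `<=` O ->
  (int_pow mu A r f <= int_pow mu B r f)%E.
Proof.
move=> oO hf mA mB AB BO; apply: ge0_subset_integral => //.
- exact: measurable_cabs_pow hf _ _.
- by move=> z _; rewrite lee_fin powR_ge0.
Qed.

Lemma int_pow_le_cst O f A r M : Cn_open O -> holomorphic_on O f ->
  measurable A -> A `<=` O -> 0 <= r -> (forall z, A z -> cabs (f z) <= M) ->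
  (int_pow mu A r f <= (M `^ r)%:E * mu A)%E.
Proof.
move=> oO hf mA AO r0 hM; rewrite -integral_cst//.
apply: ge0_le_integral => //.
- by move=> z _; rewrite lee_fin powR_ge0.
- exact: measurable_cabs_pow hf _ _.
- move=> z Az; rewrite lee_fin ge0_ler_powR ?nnegrE ?cabs_ge0 ?hM//.
  exact: le_trans (cabs_ge0 _) (hM _ Az).
Qed.

Lemma int_pow_ge_cst O f A r M : Cn_open O -> holomorphic_on O f ->
  measurable A -> A `<=` O -> 0 <= r -> 0 <= M -> (forall z, A z -> M <= cabs (f z)) ->
  ((M `^ r)%:E * mu A <= int_pow mu A r f)%E.
Proof.
move=> oO hf mA AO r0 M0 hM; rewrite -integral_cst//.
apply: ge0_le_integral => //.
- by move=> z _; rewrite lee_fin powR_ge0.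
- exact: measurable_cabs_pow hf _ _.
- by move=> z Az; rewrite lee_fin ge0_ler_powR ?nnegrE ?cabs_ge0 ?hM//.
Qed.

(** The sum is at most twice the larger term. This covers every exponent [r >= 0] without
    convexity. *)
Lemma powR_add_le (x y : R) r : 0 <= r -> 0 <= x -> 0 <= y ->
  (x + y) `^ r <= 2 `^ r * (x `^ r + y `^ r).
Proof.
move=> r0 x0 y0; have [xy|/ltW yx] := leP x y.
  apply: (@le_trans _ _ ((2 * y) `^ r)).
    by rewrite ge0_ler_powR ?nnegrE ?addr_ge0 ?mulr_ge0//; lra.
  by rewrite powRM// ler_wpM2l ?powR_ge0// lerDr powR_ge0.
apply: (@le_trans _ _ ((2 * x) `^ r)).
  by rewrite ge0_ler_powR ?nnegrE ?addr_ge0 ?mulr_ge0//; lra.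
by rewrite powRM// ler_wpM2l ?powR_ge0// lerDl powR_ge0.
Qed.

Lemma int_pow_add_le O f g h A r : Cn_open O ->
  holomorphic_on O f -> holomorphic_on O g -> holomorphic_on O h ->
  measurable A -> A `<=` O -> 0 <= r ->
  (forall z, A z -> cabs (f z) <= cabs (g z) + cabs (h z)) ->
  (int_pow mu A r f <= (2 `^ r)%:E * (int_pow mu A r g + int_pow mu A r h))%E.
Proof.
move=> oO hf hg hh mA AO r0 fgh.
have mf := measurable_cabs_pow r oO hf mA AO.
have mg := measurable_cabs_pow r oO hg mA AO.
have mh := measurable_cabs_pow r oO hh mA AO.
have p0 (k : Cn -> C) (z : CnB) : A z -> (0 <= (cabs (k z) `^ r)%:E)%E.
  by rewrite lee_fin powR_ge0.
rewrite /int_pow -ge0_integralD//; [|exact: p0|exact: p0].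
rewrite -ge0_integralZl//; last 2 first.
- exact: emeasurable_funD.
- by move=> z Az; rewrite adde_ge0 ?p0.
apply: ge0_le_integral => //; first exact: p0.
  by apply: measurable_funeM; exact: emeasurable_funD.
move=> z Az; rewrite -EFinD -EFinM lee_fin.
apply: le_trans (powR_add_le r0 (cabs_ge0 _) (cabs_ge0 _)).
by rewrite ge0_ler_powR ?nnegrE ?addr_ge0 ?cabs_ge0 ?fgh.
Qed.

Lemma int_powZ O f (c : C) A r : Cn_open O -> holomorphic_on O f ->
  measurable A -> A `<=` O ->
  int_pow mu A r (fun z => c * f z) = ((cabs c `^ r)%:E * int_pow mu A r f)%E.
Proof.
move=> oO hf mA AO; have mf := measurable_cabs_pow r oO hf mA AO.
have r0 t : (0 <= (t `^ r)%:E :> \bar R)%E by rewrite lee_fin powR_ge0.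
rewrite /int_pow -(ge0_integralZl mu mA mf (fun z _ => r0 _) (r0 _)).
by apply: eq_integral => z _; rewrite cabsM powRM ?cabs_ge0// EFinM.
Qed.

Lemma int_pow_split O f A B r : Cn_open O -> holomorphic_on O f ->
  measurable A -> measurable B -> A `<=` B -> B `<=` O ->
  int_pow mu B r f = (int_pow mu A r f + int_pow mu (B `\` A) r f)%E.
Proof.
move=> oO hf mA mB AB BO; rewrite /int_pow -{1}(setDUK AB) ge0_integral_setU//.
- exact: measurableD.
- by rewrite setDUK //; exact: measurable_cabs_pow hf _ _.
- by move=> z _; rewrite lee_fin powR_ge0.
- by apply/disj_setPS => z [? []].
Qed.

(** Monotone convergence of the cut-offs of [F] to [K m]; the strict inequality is an open
    condition, so it already holds for some [m], even when the full integral is infinite. *)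
Lemma integral_exhaustion (F : CnB -> \bar R) (K : nat -> set CnB) A (c : \bar R) :
  measurable A -> measurable_fun A F -> (forall z, A z -> (0 <= F z)%E) ->
  (forall m, measurable (K m)) -> (forall m, K m `<=` A) ->
  (forall m l, (m <= l)%N -> K m `<=` K l) -> A `<=` \bigcup_m K m ->
  (c < \int[mu]_(z in A) F z)%E -> exists m, (c < \int[mu]_(z in K m) F z)%E.
Proof.
move=> mA mF F0 mK KA Kmono AK cF.
pose G m := F \_ (K m).
have intG m : (\int[mu]_(z in A) G m z = \int[mu]_(z in K m) F z)%E.
  by rewrite /G -integral_mkcondr setIidr.
have G0 m z : A z -> (0 <= G m z)%E.
  by move=> Az; rewrite /G patchE; case: ifP => // _; exact: F0.
have cvgG := @cvg_monotone_convergence _ _ _ mu A mA G.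
have limG z : A z -> limn (G^~ z) = F z.
  move=> Az; have [m _ Kz] := AK _ Az; apply/cvg_lim => //.
  apply: cvg_near_cst; exists m => // l /= ml; rewrite /G patchE.
  by rewrite mem_set//; apply: Kmono ml _ Kz.
have : (\int[mu]_(z in A) G m z @[m --> \oo] --> \int[mu]_(z in A) F z)%E.
  rewrite [X in _ --> X](_ : _ = (\int[mu]_(z in A) limn (G^~ z))%E); last first.
    by apply: eq_integral => z /set_mem /limG.
  apply: cvgG => //.
  - move=> m; rewrite /G; apply/(measurable_restrict _ (mK m) mA).
    by apply: measurable_funS mF => //; exact: subIsetl.
  - move=> z Az m l ml; rewrite /G !patchE; case: ifPn => [/set_mem Kz|_].
      by rewrite mem_set//; apply: Kmono ml _ Kz.
    by case: ifP => // _; exact: F0.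
move=> /(_ [set y | (c < y)%E]) [|m _ /(_ m (leqnn _)) /= hm].
  by apply: open_nbhs_nbhs; split=> //; exact: open_ereal_gt_ereal.
by exists m; rewrite -intG.
Qed.

(** * Volumes of cubes and the local bound of a function by its integral *)

Lemma Cn_box_measurable (a b c d : 'I_n -> R) : measurable (Cn_box a b c d).
Proof.
rewrite -[Cn_box _ _ _ _]setCK; apply: measurableC; apply: Cn_open_measurable => z /= zB.
have /existsNP[j hj] : ~ (forall j, a j <= Re (z j) <= b j /\ c j <= Im (z j) <= d j) by [].
have key w e : cdist w z < e ->
    `|Re (w j) - Re (z j)| < e /\ `|Im (w j) - Im (z j)| < e.
  move=> wz; have := le_lt_trans (cabs_le_cdist w z j) wz => h.
  by rewrite -ReB -ImB; split; apply: le_lt_trans h; [exact: abs_Re_le|exact: abs_Im_le].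
have out e : 0 < e -> (forall x y, `|x - Re (z j)| < e -> `|y - Im (z j)| < e ->
    ~ (a j <= x <= b j /\ c j <= y <= d j)) ->
    exists2 e : R, 0 < e & forall w, cdist w z < e -> ~ Cn_box a b c d w.
  by move=> e0 h; exists e => // w /key[h1 h2] /(_ j); exact: h h1 h2.
have [h1|h1] := ltP (Re (z j)) (a j).
  by apply: (out (a j - Re (z j))) => [|x y]; rewrite ?subr_gt0// !ltr_norml; lra.
have [h2|h2] := ltP (b j) (Re (z j)).
  by apply: (out (Re (z j) - b j)) => [|x y]; rewrite ?subr_gt0// !ltr_norml; lra.
have [h3|h3] := ltP (Im (z j)) (c j).
  by apply: (out (c j - Im (z j))) => [|x y]; rewrite ?subr_gt0// !ltr_norml; lra.
have [h4|h4] := ltP (d j) (Im (z j)).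
  by apply: (out (Im (z j) - d j)) => [|x y]; rewrite ?subr_gt0// !ltr_norml; lra.
by case: hj; rewrite h1 h2 h3 h4.
Qed.

(** Takes the place of a ball of [cdist], because [is_lebesgue_Cn] prescribes the volumes of
    boxes. *)
Definition cube z (s : R) : set CnB :=
  Cn_box (fun j => Re (z j) - s) (fun j => Re (z j) + s)
         (fun j => Im (z j) - s) (fun j => Im (z j) + s).

Lemma cube_measure z (s : R) : is_lebesgue_Cn mu -> 0 <= s ->
  mu (cube z s) = (((2 * s) ^+ 2) ^+ n)%:E.
Proof.
move=> hmu s0; rewrite /cube hmu => [|j]; last by lra.
congr EFin; rewrite -[RHS](_ : \prod_(j < n) ((2 * s) ^+ 2) = _); last first.
  by rewrite prodr_const card_ord.
by apply: eq_bigr => j _; ring.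
Qed.

Lemma cube_cdist z w (s : R) : 0 <= s -> cube z s w -> cdist w z <= 2 * s.
Proof.
move=> s0 h; apply: cdist_le => [|j]; first by rewrite mulr_ge0.
have [h1 h2] := h j; apply: le_trans (cabs_le_ReIm _) _.
have : `|Re (w j - z j)| <= s by rewrite ReB ler_norml; lra.
have : `|Im (w j - z j)| <= s by rewrite ImB ler_norml; lra.
lra.
Qed.

Lemma cdist_cube z w (s : R) : cdist w z <= s -> cube z s w.
Proof.
move=> h j; have := le_trans (cabs_le_cdist w z j) h => hj.
have := le_trans (abs_Re_le _) hj; have := le_trans (abs_Im_le _) hj.
by rewrite ReB ImB !ler_norml; lra.
Qed.

(** Substitute for the mean value property. If [|f|] stayed below [K * |f z|] within [r / 8] of [z],
    the Lipschitz estimate would keep it above [|f z| / 2] on a cube of side [eta * r], and the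
    integral over this cube alone would contradict the lower bound on [|f z|]. *)
Lemma doubling_step p (K : R) : is_lebesgue_Cn mu -> 0 <= p -> 1 <= K ->
  exists2 C1 : R, 0 < C1 & forall O f z r (a : R), Cn_open O -> holomorphic_on O f ->
    0 < r -> (forall w, cdist w z < r -> O w) -> int_pow mu O p f = a%:E ->
    C1 * a < cabs (f z) `^ p * (r ^+ 2) ^+ n ->
    exists2 z', cdist z' z < r / 8 & K * cabs (f z) < cabs (f z').
Proof.
move=> hmu p0 K1.
have [Lam LamE Lam0] : exists2 Lam : R, Lam = 2048 & 0 < Lam.
  by exists 2048; [reflexivity | rewrite ltr0n].
have K0 : 0 < K by lra.
have LK0 : 0 < 16 * Lam * K by rewrite !mulr_gt0.
(* The bound [64^-1] is what the Lipschitz estimate on radius [r / 8] requires; the other bound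
   keeps the oscillation of [f] on the cube below [|f z| / 2]. *)
have [eta [eta0 eta1 eta2]] : exists eta : R, [/\ 0 < eta, eta <= 64^-1 & 8 * Lam * K * eta <= 2^-1].
  exists (Num.min 64^-1 (16 * Lam * K)^-1); split.
  - by rewrite lt_min !invr_gt0 LK0 ltr0n.
  - by rewrite ge_min lexx.
  apply: (@le_trans _ _ (8 * Lam * K * (16 * Lam * K)^-1)).
    by rewrite ler_pM2l ?ge_min ?lexx ?orbT// !mulr_gt0.
  by rewrite le_eqVlt; apply/orP; left; apply/eqP; field; rewrite !gt_eqF.
have e2n : 0 < (eta ^+ 2) ^+ n by rewrite !exprn_gt0.
exists (2 `^ p / (eta ^+ 2) ^+ n); first by rewrite divr_gt0 ?powR_gt0.
move=> O f z r a oO hf r0 rO ha big; apply: contrapT => nz'.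
have fK w : cdist w z < r / 8 -> cabs (f w) <= K * cabs (f z).
  by move=> wz; rewrite leNgt; apply/negP => hw; apply: nz'; exists w.
have half w : cdist w z <= eta * r -> cabs (f z) / 2 <= cabs (f w).
  move=> wz; have er : eta * r <= 64^-1 * r by rewrite ler_pM2r.
  have := @holomorphic_lipschitz R n O f z (r / 8) (K * cabs (f z)) w hf.
  rewrite -LamE => /(_ _ _ _)/=.
  have h1 : 0 < r / 8 by rewrite divr_gt0.
  have h2 v : cdist v z < r / 8 -> O v /\ cabs (f v) <= K * cabs (f z).
    by move=> vz; split; [apply: rO; lra | exact: fK].
  move/(_ h1 h2); have h3 : cdist w z <= r / 8 / 8 by lra.
  move/(_ h3) => h4.
  have h5 : Lam * (K * cabs (f z)) / (r / 8) * cdist w z <= cabs (f z) / 2.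
    apply: (@le_trans _ _ (Lam * (K * cabs (f z)) / (r / 8) * (eta * r))).
      by rewrite ler_wpM2l// divr_ge0 ?(ltW h1)// !mulr_ge0 ?cabs_ge0 ?(ltW Lam0) ?(ltW K0).
    have -> : Lam * (K * cabs (f z)) / (r / 8) * (eta * r) = 8 * Lam * K * eta * cabs (f z).
      by field; rewrite gt_eqF.
    by rewrite mulrC ler_wpM2l ?cabs_ge0.
  have := cabs_le_add (f z) (f w); rewrite cabsC; lra.
pose s := eta * r / 2.
have s0 : 0 <= s by rewrite !mulr_ge0 ?invr_ge0 ?(ltW eta0) ?(ltW r0).
have cO w : cube z s w -> cdist w z <= eta * r.
  by move=> /(cube_cdist s0); rewrite /s; lra.
have er : eta * r <= 64^-1 * r by rewrite ler_pM2r.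
have cO' : cube z s `<=` O by move=> w /cO wz; apply: rO; lra.
have mc : measurable (cube z s) by exact: Cn_box_measurable.
have : (((cabs (f z) / 2) `^ p * ((2 * s) ^+ 2) ^+ n)%:E <= a%:E)%E.
  rewrite EFinM -(cube_measure z hmu s0) -ha.
  apply: (@le_trans _ _ (int_pow mu (cube z s) p f)); last first.
    by apply: (@int_pow_subset O) => //; exact: Cn_open_measurable.
  apply: (@int_pow_ge_cst O) => //; first by rewrite divr_ge0 ?cabs_ge0.
  by move=> w /cO /half.
rewrite lee_fin => ale; move: big; apply/negP; rewrite -leNgt.
have -> : cabs (f z) `^ p * (r ^+ 2) ^+ n
    = 2 `^ p / (eta ^+ 2) ^+ n * ((cabs (f z) / 2) `^ p * ((2 * s) ^+ 2) ^+ n).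
  have -> : ((2 * s) ^+ 2) ^+ n = (eta ^+ 2) ^+ n * (r ^+ 2) ^+ n.
    by rewrite -exprMn; congr (_ ^+ n); rewrite -exprMn; congr (_ ^+ 2); rewrite /s; lra.
  have -> : cabs (f z) `^ p = 2 `^ p * (cabs (f z) / 2) `^ p.
    by rewrite -powRM ?divr_ge0 ?cabs_ge0//; congr (_ `^ p); field.
  rewrite -!mulrA; congr (_ * _); rewrite [RHS]mulrCA; congr (_ * _).
  by rewrite mulKf // gt_eqF.
by rewrite ler_wpM2l// divr_ge0 ?powR_ge0// ltW.
Qed.

(* If the bound fails at [z], iterating [doubling_step] yields points [z_k] that
   converge inside [O] although [|f z_k|] tends to infinity. *)
Lemma int_pow_local_bound p r : is_lebesgue_Cn mu -> 1 <= p -> 0 < r ->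
  exists2 C1 : R, 0 < C1 & forall O f z, Cn_open O -> holomorphic_on O f ->
    (forall w, cdist w z < r -> O w) ->
    ((cabs (f z) `^ p)%:E <= C1%:E * int_pow mu O p f)%E.
Proof.
move=> hmu p1 r0; have p0 : 0 <= p by lra.
(* Halving the radius divides [(r ^+ 2) ^+ n] by [4 ^+ n]. As [p >= 1], the gain [K ^ p >= K]
   outweighs this loss, and [K >= 2] makes [|f|] at least double. *)
pose K : R := 2 * 4 ^+ n.
have K2 : 2 <= K by rewrite /K ler_peMr// exprn_ege1//; lra.
have K1 : 1 <= K by lra.
have [C1 C10 step] := doubling_step hmu p0 K1.
have rn0 : 0 < (r ^+ 2) ^+ n by rewrite !exprn_gt0.
exists (C1 / (r ^+ 2) ^+ n) => [|O f z oO hf zO]; first by rewrite divr_gt0.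
have := int_pow_ge0 O p f; case E: (int_pow mu O p f) => [a||]// a0; last first.
  by rewrite gt0_muley ?lte_fin ?divr_gt0// leey.
rewrite -EFinM lee_fin mulrAC ler_pdivlMr// leNgt; apply/negP => big.
rewrite lee_fin in a0.
pose rk k := r * 2^-1 ^+ k.
have rk0 k : 0 < rk k by rewrite mulr_gt0 ?exprn_gt0.
have rkS k : rk k.+1 = rk k / 2 by rewrite /rk exprSr mulrA.
pose P k z := (forall w, cdist w z < rk k -> O w) /\
  C1 * a < cabs (f z) `^ p * (rk k ^+ 2) ^+ n.
have next (kz : nat * Cn) : exists z', P kz.1 kz.2 ->
    [/\ P kz.1.+1 z', cdist z' kz.2 < rk kz.1 / 8 & 2 * cabs (f kz.2) <= cabs (f z')].
  case: kz => k y /=; have [[yO hy]|nP] := pselect (P k y); last by exists y.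
  have [y' y'y fy'] := step _ _ _ _ _ oO hf (rk0 k) yO E hy.
  exists y' => _; split=> //; last first.
    by apply: le_trans (ltW fy'); rewrite ler_wpM2r ?cabs_ge0.
  split=> [w wy'|].
    by apply: yO; have := cdist_triangle y' w y; have := rk0 k; rewrite rkS in wy'; lra.
  apply: lt_le_trans hy _.
  have -> : cabs (f y) `^ p * (rk k ^+ 2) ^+ n = (cabs (f y) `^ p * 4 ^+ n) * (rk k.+1 ^+ 2) ^+ n.
    by rewrite -mulrA -exprMn; congr (_ * (_ ^+ n)); rewrite rkS; field.
  rewrite ler_pM2r; last by rewrite !exprn_gt0.
  apply: (@le_trans _ _ ((K * cabs (f y)) `^ p)); last first.
    by rewrite ge0_ler_powR ?nnegrE ?cabs_ge0 ?(ltW fy')// mulr_ge0 ?cabs_ge0//; lra.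
  rewrite powRM ?cabs_ge0//; last by lra.
  rewrite mulrC ler_wpM2r ?powR_ge0//.
  apply: (@le_trans _ _ K); last by rewrite le1r_powR//; lra.
  by rewrite /K ler_peMl ?exprn_ge0//; lra.
have [nxt hnxt] := choice next.
pose zz := fix zz k := if k is k'.+1 then nxt (k', zz k') else z.
have zzP k : P k (zz k).
  elim: k => [|k IH]; first by rewrite /P /rk expr0 mulr1; split.
  by have [] := hnxt (k, zz k) IH.
have zzS k : cdist (zz k.+1) (zz k) < rk k / 8 /\ 2 * cabs (f (zz k)) <= cabs (f (zz k.+1)).
  by have [] := hnxt (k, zz k) (zzP k).
(* The distances telescope because [rk k / 8 = (rk k - rk k.+1) / 4]. *)
have zzd k l : (k <= l)%N -> cdist (zz l) (zz k) <= (rk k - rk l) / 4.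
  elim: l => [|l IH]; first by rewrite leqn0 => /eqP ->; rewrite cdist_refl subrr mul0r.
  rewrite leq_eqVlt => /predU1P[->|/IH]; first by rewrite cdist_refl subrr mul0r.
  have [h _] := zzS l; have := cdist_triangle (zz l) (zz l.+1) (zz k).
  by rewrite rkS; lra.
have [||x hx] := @cn_limit R n zz (fun k => rk k / 4).
- by move=> k; have := rk0 k; lra.
- move=> k l; have := rk0 k; have := rk0 l => h1 h2.
  have [kl|/ltnW lk] := leqP k l.
    by rewrite cdistC; apply: le_trans (zzd _ _ kl) _; lra.
  by apply: le_trans (zzd _ _ lk) _; lra.
have Ox : O x.
  by apply: zO; have := hx 0%N; rewrite /= /rk expr0 mulr1 cdistC; lra.
have [//|d d0 hd] := holomorphic_continuous hf Ox (e := 1).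
have fz0 : 0 < cabs (f z).
  rewrite lt_neqAle cabs_ge0 andbT; apply/eqP => fz; move: big.
  rewrite -fz powR0 ?mul0r ?gt_eqF//; last by lra.
  by rewrite ltNge mulr_ge0// ltW.
have grow k : 2 ^+ k * cabs (f z) <= cabs (f (zz k)).
  elim: k => [|k IH]; first by rewrite expr0 mul1r.
  by have [_ h] := zzS k; rewrite exprS; lra.
have [k1 hk1] := archi_pow2 ((cabs (f x) + 1) / cabs (f z)).
have [|k2 hk2] := @exp2V_small R (d / r); first by rewrite divr_gt0.
pose k := maxn k1 k2; have {}hk2 := hk2 k (leq_maxr _ _).
have h1 : cdist (zz k) x < d.
  apply: le_lt_trans (hx k) _; move: hk2; rewrite ltr_pdivlMr// => h.
  by have := rk0 k; rewrite /rk in h *; lra.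
have h2 : cabs (f x) + 1 < 2 ^+ k * cabs (f z).
  rewrite -ltr_pdivrMr//; apply: lt_le_trans hk1 _.
  by rewrite ler_weXn2l ?leq_maxl//; lra.
have := hd _ h1; have := grow k; have := cabs_le_add (f (zz k)) (f x); lra.
Qed.

End IntPow.

(** * Exhaustion of the domain by inner sets *)

Section Exhaustion.
Variables (R : realType) (n : nat) (mu : {measure set (CnB R n) -> \bar R}).
Variable O : set (Cn R n).
Notation C := R[i].
Notation Cn := (Cn R n).
Notation CnB := (CnB R n).
Implicit Types (z w : Cn) (f g h : Cn -> C) (p r e M : R).

Definition inner_set (m : nat) : set CnB :=
  [set z | forall w : Cn, cdist w z < 2^-1 ^+ m -> O w].

Lemma inner_set_sub m : inner_set m `<=` O.
Proof. by move=> z; apply; rewrite cdist_refl exprn_gt0. Qed.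

Lemma inner_set_le m l : (m <= l)%N -> inner_set m `<=` inner_set l.
Proof.
move=> ml z zm w wz; apply: zm; apply: lt_le_trans wz _.
by apply: ler_wiXn2l => //; lra.
Qed.

Lemma inner_set_measurable m : measurable (inner_set m).
Proof.
rewrite -[inner_set m]setCK; apply: measurableC; apply: Cn_open_measurable => z /=.
move=> /existsNP[w /not_implyP[wz nOw]].
exists (2^-1 ^+ m - cdist w z); first by rewrite subr_gt0.
move=> z' z'z zm; apply: nOw; apply: zm.
by have := cdist_triangle z w z'; rewrite (cdistC z z'); lra.
Qed.

Hypothesis oO : Cn_open O.

Lemma inner_set_bigcup : O `<=` \bigcup_m inner_set m.
Proof.
move=> z /oO[e e0 he]; have [k /(_ _ (leqnn _)) hk] := exp2V_small e0.
by exists k => // w wz; apply: he; exact: lt_trans hk.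
Qed.

Lemma inner_set_ball m z w : inner_set m z -> cdist w z <= 2^-1 ^+ m.+1 ->
  inner_set m.+1 w.
Proof.
move=> zm wz v vw; apply: zm; have := cdist_triangle w v z.
by rewrite exprS in wz vw; lra.
Qed.

Lemma bounded_measure_lty (A : set CnB) : is_lebesgue_Cn mu -> Cn_bounded O ->
  measurable A -> A `<=` O -> (mu A < +oo)%E.
Proof.
move=> hmu [M hM] mA AO; have M0 : 0 <= `|M| by [].
apply: (@le_lt_trans _ _ (mu (cube (fun=> 0) `|M|))); last by rewrite cube_measure// ltry.
apply: le_measure; rewrite ?inE//; first exact: Cn_box_measurable.
by move=> z /AO/hM zM; apply: cdist_cube; exact: le_trans (ler_norm _).
Qed.

Lemma cst_holomorphic (c : C) : holomorphic_on O (fun=> c).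
Proof.
move=> z _; exists (fun=> 0) => e e0; exists 1 => // w _.
rewrite big1 ?subrr ?subr0 ?cabs0 ?mulr_ge0 ?cdist_ge0 ?(ltW e0)// => j _.
by rewrite mul0r.
Qed.

(** The error bound enters [int_pow_add_le] as the constant function [e]. *)
Lemma int_pow_perturb f g (A : set CnB) r e : 0 <= r -> 0 <= e ->
  holomorphic_on O f -> holomorphic_on O g -> measurable A -> A `<=` O ->
  (forall z, A z -> cabs (f z - g z) <= e) ->
  (int_pow mu A r f <= (2 `^ r)%:E * (int_pow mu A r g + (e `^ r)%:E * mu A))%E.
Proof.
move=> r0 e0 hf hg mA AO fg.
have ce : cabs (real_complex R e) = e by rewrite cabs_real ger0_norm.
apply: (@le_trans _ _ ((2 `^ r)%:E *
    (int_pow mu A r g + int_pow mu A r (fun=> real_complex R e)))%E).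
  apply: (@int_pow_add_le R n mu O) => //; first exact: cst_holomorphic.
  by move=> z Az; rewrite ce; apply: le_trans (cabs_le_add _ (g z)) _; rewrite lerD2l fg.
rewrite lee_pmul2l ?lte_fin ?powR_gt0// leeD2l//.
apply: (@int_pow_le_cst R n mu O) => //; first exact: cst_holomorphic.
by move=> z _; rewrite ce.
Qed.

(** Smallness in [L^p] gives uniform smallness on an inner set: if [A] is the constant of the local
    bound for the radius [2^-1 ^+ m], then [tau = e ^ p / A] works. *)
Lemma inner_set_small p m e : is_lebesgue_Cn mu -> 1 <= p -> 0 < e ->
  exists2 tau : R, 0 < tau & forall f, holomorphic_on O f ->
    (int_pow mu O p f <= tau%:E)%E -> forall z, inner_set m z -> cabs (f z) <= e.
Proof.
move=> hmu p1 e0.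
have [|A A0 hA] := int_pow_local_bound hmu p1 (r := 2^-1 ^+ m).
  by rewrite exprn_gt0.
have ep : 0 < e `^ p by rewrite powR_gt0.
exists (e `^ p / A) => [|f hf fp z zm]; first by rewrite divr_gt0.
have := hA _ _ _ oO hf zm; have : (A%:E * int_pow mu O p f <= (e `^ p)%:E)%E.
  apply: (@le_trans _ _ (A%:E * (e `^ p / A)%:E)%E).
    by rewrite lee_pmul2l ?lte_fin.
  by rewrite -EFinM lee_fin mulrC divfK ?gt_eqF.
move=> h1 /le_trans/(_ h1); rewrite lee_fin leNgt => h2; rewrite leNgt.
apply: contra h2 => h2; apply: gt0_ltr_powR; rewrite ?nnegrE ?cabs_ge0 ?(ltW e0)//; lra.
Qed.

End Exhaustion.

(** * Closed subspaces of the Bergman space *)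

Lemma ereal_cvg0 (R : realType) (u : nat -> \bar R) : (forall k, (0 <= u k)%E) ->
  (forall e : R, 0 < e -> exists N, forall k, (N <= k)%N -> (u k <= e%:E)%E) ->
  u k @[k --> \oo] --> 0%E.
Proof.
move=> u0 hu; apply/fine_cvgP; split.
  have [//|N hN] := hu 1; exists N => // k /= Nk.
  by rewrite ge0_fin_numE//; apply: le_lt_trans (hN _ Nk) _; rewrite ltry.
apply/cvgr0Pnorm_le => e e0; have [N hN] := hu _ e0; exists N => // k /= Nk.
rewrite ger0_norm ?fine_ge0//; have := hN _ Nk.
by have := u0 k; case: (u k) => //= x _; rewrite lee_fin.
Qed.

Section ClosedSubspace.
Variables (R : realType) (n : nat) (mu : {measure set (CnB R n) -> \bar R}).
Variables (O : set (Cn R n)) (p : R) (E : set (Cn R n -> R[i])).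
Notation C := R[i].
Notation Cn := (Cn R n).
Notation CnB := (CnB R n).
Notation K := (inner_set O).
Implicit Types (z w : Cn) (f g h : Cn -> C) (r e M : R).
Hypotheses (hmu : is_lebesgue_Cn mu) (oO : Cn_open O) (bO : Cn_bounded O) (p1 : 1 <= p).
Hypotheses (subE : Bergman_subspace mu O p E) (clE : Bergman_closed mu O p E).

Let p0 : 0 <= p. Proof. exact: le_trans ler01 p1. Qed.
Let pgt0 : 0 < p. Proof. exact: lt_le_trans ltr01 p1. Qed.
Let mO : measurable (O : set CnB). Proof. exact: Cn_open_measurable. Qed.
Let muO : (mu (O : set CnB) < +oo)%E. Proof. exact: (bounded_measure_lty hmu bO mO). Qed.
Let mK m : measurable (K m). Proof. exact: inner_set_measurable. Qed.
Let KO m : K m `<=` O. Proof. exact: inner_set_sub. Qed.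
Let V : R := fine (mu (O : set CnB)).
Let V0 : 0 <= V. Proof. exact: fine_ge0. Qed.
Let muOE : mu (O : set CnB) = V%:E. Proof. by rewrite fineK// ge0_fin_numE. Qed.
Let muK m : (mu (K m) <= V%:E)%E.
Proof. by rewrite -muOE le_measure// inE. Qed.
Let E_holo f : E f -> holomorphic_on O f.
Proof. by move=> Ef; have [h _ _ _] := subE; have [] := h _ Ef. Qed.
Let E_fin f : E f -> (int_pow mu O p f < +oo)%E.
Proof. by move=> Ef; have [h _ _ _] := subE; have [] := h _ Ef. Qed.
Let EZ (c : C) f : E f -> E (fun z => c * f z).
Proof. by move=> Ef; have [_ _ _ h] := subE; exact: h. Qed.
Let ED f g : E f -> E g -> E (fun z => f z + g z).
Proof. by move=> Ef Eg; have [_ _ hD _] := subE; exact: hD. Qed.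

(* With this ratio, the quasi-triangle inequality
   [int |f + g|^p <= 2^p (int |f|^p + int |g|^p)] still sums geometric tails. *)
Definition tail_ratio : R := (2 * 2 `^ p)^-1.

Lemma tail_ratio_gt0 : 0 < tail_ratio.
Proof. by rewrite invr_gt0 mulr_gt0 ?powR_gt0. Qed.

Lemma tail_ratio_le : tail_ratio <= 2^-1.
Proof.
have h : 1 <= 2 `^ p :> R by rewrite -[leLHS](powRr0 2) ler_powR//; lra.
by rewrite /tail_ratio lef_pV2 ?posrE ?mulr_gt0 ?powR_gt0 ?ltr0n//; lra.
Qed.

(** * Limits of rapidly converging sequences in [E] *)

Section FastCauchy.
Variables (g : nat -> Cn -> C) (m : nat -> nat).
Hypotheses (Eg : forall k, E (g k)) (km : forall k, (k <= m k)%N)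
  (mS : forall k, (m k <= m k.+1)%N)
  (gK : forall k z, K (m k) z -> cabs (g k.+1 z - g k z) <= 2^-1 ^+ k)
  (gp : forall k, (int_pow mu O p (fun z => g k.+1 z - g k z)%R <= (tail_ratio ^+ k)%:E)%E).

Let m_le k l : (k <= l)%N -> (m k <= m l)%N.
Proof.
move=> /subnK <-; elim: (l - k)%N => [//|i IH]; rewrite addSn.
exact: leq_trans IH (mS _).
Qed.

(** The bound is the sum of [2^-1 ^+ i] for [i] from [k] to [l - 1]; each increment is controlled at
    [z] because the inner sets grow. *)
Lemma fast_cauchy_pointwise k l z : (k <= l)%N -> K (m k) z ->
  cabs (g l z - g k z) <= 2 * (2^-1 ^+ k - 2^-1 ^+ l).
Proof.
move=> kl zK; elim: l kl => [|l IH].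
  by rewrite leqn0 => /eqP ->; rewrite !subrr cabs0 mulr0.
rewrite leq_eqVlt => /predU1P[->|]; first by rewrite !subrr cabs0 mulr0.
rewrite ltnS => kl; have h1 := IH kl.
have h2 := gK (inner_set_le (m_le kl) zK).
have -> : g l.+1 z - g k z = (g l.+1 z - g l z) + (g l z - g k z) by ring.
apply: le_trans (cabsD _ _) _.
by rewrite exprS; lra.
Qed.

(** Induction on the number of increments, splitting off the first. As [2 * 2 ^ p * tail_ratio = 1],
    the bound for the rest is [tail_ratio ^+ k], equal to that for the first increment, so the
    quasi-triangle inequality reproduces the claim. *)
Lemma fast_cauchy_int k l : (k <= l)%N ->
  (int_pow mu O p (fun z => g l z - g k z)%R <= (2 * 2 `^ p * tail_ratio ^+ k)%:E)%E.
Proof.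
move=> /subnK <-; move: (l - k)%N => i {l}; elim: i k => [|i IH] k.
  rewrite add0n; apply: le_trans (_ : ((0 `^ p)%:E * mu (O : set CnB) <= _)%E).
    apply: (@int_pow_le_cst R n mu O) => //.
      by apply: holomorphicB; exact: E_holo.
    by move=> z _; rewrite subrr cabs0.
  rewrite powR0 ?mul0e ?lee_fin; last by rewrite gt_eqF.
  by rewrite !mulr_ge0 ?powR_ge0 ?exprn_ge0 ?(ltW tail_ratio_gt0).
apply: le_trans (_ : ((2 `^ p)%:E * (int_pow mu O p (fun z => g k.+1 z - g k z)%R
    + int_pow mu O p (fun z => g (i + k.+1)%N z - g k.+1 z)%R) <= _)%E).
  apply: (@int_pow_add_le R n mu O) => //; [by apply: holomorphicB; exact: E_holo..|].
  move=> z _ /=; rewrite addSnnS.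
  have -> : g (i + k.+1)%N z - g k z = (g (i + k.+1)%N z - g k.+1 z) + (g k.+1 z - g k z) by ring.
  by rewrite [leRHS]addrC cabsD.
apply: (@le_trans _ _ ((2 `^ p)%:E * ((tail_ratio ^+ k)%:E + (2 * 2 `^ p * tail_ratio ^+ k.+1)%:E))%E).
  by rewrite lee_pmul2l ?lte_fin ?powR_gt0// leeD// IH.
rewrite -EFinD -EFinM lee_fin exprS mulrA.
have -> : 2 * 2 `^ p * tail_ratio = 1 by rewrite mulfV// mulf_neq0 ?gt_eqF ?powR_gt0.
by rewrite mul1r; lra.
Qed.

(** The sequence converges pointwise, uniformly on inner sets, so the limit is holomorphic on [O].
    The integral bounds pass to the limit and show convergence in [L^p]; closedness then supplies a
    member of [E] that agrees with the limit on [O]. *)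
Lemma fast_cauchy_limit : exists2 f, E f &
  forall k z, K (m k) z -> cabs (g k z - f z) <= 4 * 2^-1 ^+ k.
Proof.
have lim z : exists x, forall k, K (m k) z -> cabs (g k z - x) <= 4 * 2^-1 ^+ k.
  have [[k0 zk0]|nz] := pselect (exists k, K (m k) z); last first.
    (* Off all the sets [K (m k)] the limit takes the default value 0. *)
    by exists 0 => k zk; exfalso; apply: nz; exists k.
  have pos k : 0 <= 2^-1 ^+ k :> R by rewrite exprn_ge0.
  have zk k : K (m (k0 + k)) z by apply: inner_set_le zk0; apply: m_le; rewrite leq_addr.
  have [|x hx] := @complex_limit R (fun k => g (k0 + k)%N z) (fun k => 2 * 2^-1 ^+ (k0 + k)).
    move=> k l /=; have [kl|/ltnW lk] := leqP k l.
      rewrite cabsC; apply: le_trans (fast_cauchy_pointwise _ (zk k)) _.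
        by rewrite leq_add2l.
      by have := pos (k0 + k)%N; have := pos (k0 + l)%N; lra.
    apply: le_trans (fast_cauchy_pointwise _ (zk l)) _; first by rewrite leq_add2l.
    by have := pos (k0 + k)%N; have := pos (k0 + l)%N; lra.
  (* Using [hx] at [k.+1] makes the distance from that term to [x] at most [2 * 2^-1 ^+ k]; the
     distance back to [g k] costs as much again. *)
  exists x => k zK; rewrite /= in hx; have kl : (k <= k0 + k.+1)%N by rewrite addnS ltnW// ltnS leq_addl.
  have h1 := hx k.+1; have h2 := fast_cauchy_pointwise kl zK.
  have h3 : (2^-1 : R) ^+ (k0 + k.+1) <= 2^-1 ^+ k.+1.
    by apply: ler_wiXn2l; [lra|lra|rewrite leq_addl].
  have -> : g k z - x = (g (k0 + k.+1)%N z - x) - (g (k0 + k.+1)%N z - g k z) by ring.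
  apply: le_trans (cabsB _ _) _; rewrite exprS in h3; have := pos k; lra.
have [f hf] := choice lim.
have small e : 0 < e -> exists k1, forall k, (k1 <= k)%N -> 4 * 2^-1 ^+ k <= e.
  move=> e0; have [|k1 hk1] := @exp2V_small R (e / 4); first by rewrite divr_gt0.
  by exists k1 => k /hk1; lra.
have holf : holomorphic_on O f.
  apply: (@holomorphic_limit R n O g) => [k|z Oz]; first exact: E_holo.
  have [i _ zi] := inner_set_bigcup oO Oz.
  exists (2^-1 ^+ i.+1); first by rewrite exprn_gt0.
  have ball w : cdist w z < 2^-1 ^+ i.+1 -> K i.+1 w.
    by move=> /ltW; exact: inner_set_ball.
  split=> [w /ball/KO//|e /small[k1 hk1]].
  exists (maxn k1 i.+1) => w /ball wK; apply: le_trans (hk1 _ (leq_maxl _ _)).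
  by apply: hf; apply: inner_set_le wK; apply: leq_trans (km _); exact: leq_maxr.
have holg k : holomorphic_on O (g k) by exact: E_holo.
pose D k := 2 * 2 `^ p * tail_ratio ^+ k.
have D0 k : 0 < D k by rewrite !mulr_gt0 ?powR_gt0 ?exprn_gt0 ?tail_ratio_gt0.
(* An argument in the manner of Fatou: a violation would already be visible on some [K i], where [f]
   is uniformly close to [g l] for large [l]. One [D k] pays for [g l - g k], the other for
   [g l - f]. *)
have dist k : (int_pow mu O p (fun z => g k z - f z)%R <= (2 `^ p * (2 * D k))%:E)%E.
  rewrite leNgt; apply/negP => big.
  have [|||||||i] := @integral_exhaustion R n mu (fun z => (cabs (g k z - f z) `^ p)%:E) K O _ _ _ _ _ _ _ _ big => //.
  - by apply: (@measurable_cabs_pow R n O) => //; exact: holomorphicB.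
  - by move=> z _; rewrite lee_fin powR_ge0.
  - by move=> a b; exact: inner_set_le.
  - exact: inner_set_bigcup.
  apply/negP; rewrite -leNgt.
  have [|k1 hk1] := small (Num.min 1 (D k / (V + 1))).
    by rewrite lt_min ltr01 divr_gt0// ltr_wpDl.
  pose l := maxn k1 (maxn k i).
  have {}hk1 := hk1 l (leq_maxl _ _).
  have kl : (k <= l)%N by rewrite /l !leq_max leqnn orbT.
  have il : (i <= l)%N by rewrite /l !leq_max leqnn !orbT.
  have el0 : 0 < 4 * 2^-1 ^+ l :> R by rewrite mulr_gt0 ?exprn_gt0.
  apply: le_trans (_ : ((2 `^ p)%:E * (int_pow mu (K i) p (fun z => g l z - g k z)%R
     + ((4 * 2^-1 ^+ l) `^ p)%:E * mu (K i)) <= _)%E).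
    have h3 : holomorphic_on O (fun z => g k z - f z) by exact: holomorphicB.
    have h4 : holomorphic_on O (fun z => f z - g l z) by exact: holomorphicB.
    have -> : int_pow mu (K i) p (fun z => g l z - g k z)%R = int_pow mu (K i) p (fun z => g k z - g l z)%R.
      by apply: eq_integral => z _; rewrite cabsC.
    apply: (@int_pow_perturb R n mu O) => //; first exact: holomorphicB.
    move=> z zi; have -> : g k z - f z - (g k z - g l z) = g l z - f z by ring.
    apply: hf; apply: inner_set_le zi; exact: leq_trans (km _).
  have D2 : 2 * D k = D k + D k by rewrite mulr_natl mulr2n.
  rewrite D2 EFinM lee_pmul2l ?lte_fin ?powR_gt0// EFinD leeD//.
    apply: le_trans (fast_cauchy_int kl).
    by apply: (@int_pow_subset R n mu O) => //; exact: holomorphicB.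
  apply: (@le_trans _ _ (((4 * 2^-1 ^+ l) `^ p)%:E * V%:E)%E).
    by rewrite lee_wpmul2l// lee_fin powR_ge0.
  move: hk1; rewrite le_min => /andP[l1 l2]; rewrite -EFinM lee_fin.
  apply: (@le_trans _ _ (4 * 2^-1 ^+ l * V)).
    by rewrite ler_wpM2r// ge1r_powR// el0.
  move: l2; rewrite ler_pdivlMr ?ltr_wpDl//; apply: le_trans.
  by rewrite ler_wpM2l ?(ltW el0)// lerDl.
have Bf : Bergman mu O p%:E f.
  split=> //; apply: (@le_lt_trans _ _ ((2 `^ p)%:E *
    (int_pow mu O p (fun z => g 0%N z - f z)%R + int_pow mu O p (g 0%N)))%E).
    apply: (@int_pow_add_le R n mu O) => //; first exact: holomorphicB.
    move=> z _; rewrite addrC cabsC; exact: cabs_le_add.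
  apply: lte_mul_pinfty; rewrite ?lee_fin ?powR_ge0//.
  apply: lte_add_pinfty; last exact: E_fin.
  by apply: le_lt_trans (dist 0%N) _; rewrite ltry.
have [|f' Ef' ff'] := clE Eg Bf.
  apply: ereal_cvg0 => [k|e e0]; first exact: poweR_ge0.
  have [|k1 hk1] := @exp2V_small R (e `^ p / (2 `^ p * (2 * (2 * 2 `^ p)))).
    by rewrite divr_gt0 ?powR_gt0// !mulr_gt0 ?powR_gt0.
  exists k1 => k /hk1 hk; rewrite /Lp_norm.
  have -> : e%:E = ((e `^ p)%:E `^ p^-1)%E.
    by rewrite poweR_EFin -powRrM mulfV ?powRr1 ?(ltW e0)// gt_eqF.
  have ip0 : 0 <= p^-1 by rewrite invr_ge0.
  apply: (gt0_ler_poweR ip0); rewrite ?in_itv/= ?leey ?andbT ?int_pow_ge0 ?lee_fin ?powR_ge0//.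
  apply: le_trans (dist k) _; rewrite lee_fin.
  move: hk; rewrite ltr_pdivlMr; last by rewrite !mulr_gt0 ?powR_gt0.
  move/ltW; apply: le_trans; rewrite /D.
  have h : tail_ratio ^+ k <= 2^-1 ^+ k.
    by rewrite lerXn2r ?nnegrE ?(ltW tail_ratio_gt0) ?tail_ratio_le.
  rewrite [leRHS]mulrC -!mulrA; do 4 (rewrite ler_wpM2l ?powR_ge0//).
exists f' => // k z zK; rewrite ff'; first exact: hf.
exact: KO zK.
Qed.

End FastCauchy.

(** * Gliding hump bound for the [L^r] norm, and concentration away from the boundary *)

Section UniformBound.
Variable r : R.
Hypotheses (pr : p < r) (rE : forall f, E f -> (int_pow mu O r f < +oo)%E).

Let rgt0 : 0 < r. Proof. exact: lt_trans pgt0 pr. Qed.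
Let r0 : 0 <= r. Proof. exact: ltW rgt0. Qed.

(** The new function is [g + c * f], with [c] so small that [g] hardly changes in [L^p] and on
    [K m0], and [f] of such large [L^r] mass that the sum exceeds [k]. The exhaustion then finds an
    inner set that carries more than [k]. *)
Lemma hump_step g m0 k :
  (forall M, exists f, [/\ E f, (int_pow mu O p f <= 1)%E & (M%:E < int_pow mu O r f)%E]) ->
  E g -> exists gm : (Cn -> C) * nat, [/\ E gm.1, (m0 <= gm.2)%N /\ (k < gm.2)%N,
    forall z, K m0 z -> cabs (gm.1 z - g z) <= 2^-1 ^+ k,
    (int_pow mu O p (fun z => gm.1 z - g z)%R <= (tail_ratio ^+ k)%:E)%E &
    (k%:R%:E < int_pow mu (K gm.2) r gm.1)%E].
Proof.
move=> unb Eg.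
have [|tau tau0 htau] := @inner_set_small R n mu O oO p m0 (2^-1 ^+ k) hmu p1.
  by rewrite exprn_gt0.
(* As [c <= 1] gives [c ^ p <= c], the [L^p] mass of [c * f] lies below both [tau] and
   [tail_ratio ^+ k]. *)
pose c := Num.min 1 (Num.min tau (tail_ratio ^+ k)).
have c0 : 0 < c by rewrite !lt_min ltr01 tau0 exprn_gt0 ?tail_ratio_gt0.
have c1 : c <= 1 by rewrite ge_min lexx.
have ctau : c <= tau by rewrite /c !ge_min lexx !orbT.
have crat : c <= tail_ratio ^+ k by rewrite /c !ge_min lexx !orbT.
have cp : c `^ p <= c by rewrite ge1r_powR// c0.
have cabsc : cabs (real_complex R c) = c by rewrite cabs_real gtr0_norm.
pose G := fine (int_pow mu O r g).
have GE : int_pow mu O r g = G%:E by rewrite fineK// ge0_fin_numE ?int_pow_ge0// rE.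
have cr0 : 0 < c `^ r by rewrite powR_gt0.
(* With this threshold [h = c * f] has [L^r] mass above [2 ^ r * (k + G)], so the quasi-triangle
   inequality for [h = (g + h) - g] forces the mass of [g + h] above [k]. *)
have [f [Ef f1 fM]] := unb (2 `^ r * (k%:R + G) / c `^ r).
pose h z := real_complex R c * f z.
have Eh : E h by exact: EZ.
have hp : (int_pow mu O p h <= c%:E)%E.
  rewrite (@int_powZ R n mu O) ?cabsc//; last exact: E_holo.
  apply: (@le_trans _ _ ((c `^ p)%:E * 1)%E).
    by rewrite lee_wpmul2l// lee_fin powR_ge0.
  by rewrite mule1 lee_fin.
have hr : ((2 `^ r * (k%:R + G))%:E < int_pow mu O r h)%E.
  rewrite (@int_powZ R n mu O) ?cabsc//; last exact: E_holo.
  rewrite -(divfK (negbT (gt_eqF cr0)) (2 `^ r * (k%:R + G))) mulrC EFinM.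
  by rewrite lte_pmul2l.
have Egh : E (fun z => g z + h z) by exact: ED.
have big : (k%:R%:E < int_pow mu O r (fun z => g z + h z)%R)%E.
  rewrite ltNge; apply/negP => small; move: hr; apply/negP; rewrite -leNgt.
  apply: (@le_trans _ _ ((2 `^ r)%:E * (int_pow mu O r (fun z => g z + h z)%R + int_pow mu O r g))%E).
    apply: (@int_pow_add_le R n mu O) => //; [exact: E_holo..|].
    move=> z _ /=; have ghz : g z + h z - g z = h z by ring.
    by rewrite -{1}ghz cabsB.
  rewrite EFinM lee_pmul2l ?lte_fin ?powR_gt0// EFinD GE.
  exact: leeD.
have [|||||||i hi] := @integral_exhaustion R n mu (fun z => (cabs (g z + h z) `^ r)%:E) K O _ _ _ _ _ _ _ _ big => //.
- by apply: (@measurable_cabs_pow R n O) => //; exact: E_holo.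
- by move=> z _; rewrite lee_fin powR_ge0.
- by move=> a b; exact: inner_set_le.
- exact: inner_set_bigcup.
have ghE : (fun z => g z + h z - g z) = h by apply/funext => z; ring.
exists (fun z => g z + h z, maxn i (maxn m0 k.+1)); split; rewrite /=.
- exact: Egh.
- by rewrite !leq_max !leqnn !orbT.
- move=> z zK; have -> : g z + h z - g z = h z by ring.
  by apply: (htau h) zK; [exact: E_holo | apply: le_trans hp _; rewrite lee_fin].
- by rewrite ghE; apply: le_trans hp _; rewrite lee_fin.
- apply: lt_le_trans hi _; apply: (@int_pow_subset R n mu O) => //; first exact: E_holo.
  by apply: inner_set_le; rewrite leq_maxl.
Qed.

(** Gliding hump: the limit [f] of the successive humps lies in [E] and stays within 4 of hump
    [k.+1] on the inner set where that hump has mass above [k]. The finite [L^r] mass of [f] would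
    thus bound every [k]. *)
Lemma uniform_bound : exists M : R, forall f, E f ->
  (int_pow mu O p f <= 1)%E -> (int_pow mu O r f <= M%:E)%E.
Proof.
apply: contrapT => nM.
have unb M : exists f, [/\ E f, (int_pow mu O p f <= 1)%E & (M%:E < int_pow mu O r f)%E].
  apply: contrapT => nf; apply: nM; exists M => f Ef f1.
  by rewrite leNgt; apply/negP => fM; apply: nf; exists f.
have next (s : nat * ((Cn -> C) * nat)) : exists gm : (Cn -> C) * nat, E s.2.1 ->
    [/\ E gm.1, (s.2.2 <= gm.2)%N /\ (s.1 < gm.2)%N,
    forall z, K s.2.2 z -> cabs (gm.1 z - s.2.1 z) <= 2^-1 ^+ s.1,
    (int_pow mu O p (fun z => gm.1 z - s.2.1 z)%R <= (tail_ratio ^+ s.1)%:E)%E &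
    (s.1%:R%:E < int_pow mu (K gm.2) r gm.1)%E].
  have [Es|nEs] := pselect (E s.2.1); last by exists s.2.
  by have [gm hgm] := hump_step s.2.2 s.1 unb Es; exists gm.
have [nxt hnxt] := choice next.
have E0 : E (fun=> 0) by have [_ ? _ _] := subE.
pose st := fix st k := if k is k'.+1 then nxt (k', st k') else ((fun=> 0) : Cn -> C, 0%N).
have Est k : E (st k).1.
  by elim: k => [//|k IH]; have [] := hnxt (k, st k) IH.
have stS k := hnxt (k, st k) (Est k).
have [|||||f Ef hf] := @fast_cauchy_limit (fun k => (st k).1) (fun k => (st k).2) => //.
- by case=> [//|k]; have [_ [_ h] _ _ _] := stS k.
- by move=> k; have [_ [h _] _ _ _] := stS k.
- by move=> k; have [_ _ h _ _] := stS k.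
- by move=> k; have [_ _ _ h _] := stS k.
pose G := fine (int_pow mu O r f).
have GE : int_pow mu O r f = G%:E by rewrite fineK// ge0_fin_numE ?int_pow_ge0// rE.
have bound k : (k%:R : R) <= 2 `^ r * (G + 4 `^ r * V).
  have [_ _ _ _ h] := stS k; rewrite -lee_fin; apply: le_trans (ltW h) _.
  apply: (@le_trans _ _ ((2 `^ r)%:E * (int_pow mu (K (st k.+1).2) r f
     + (4 `^ r)%:E * mu (K (st k.+1).2)))%E).
    apply: (@int_pow_perturb R n mu O oO _ _ _ r 4 r0 (ler0n _ 4) (E_holo (Est k.+1)) (E_holo Ef)
      (mK _) (@KO _)).
    move=> z zK; apply: le_trans (hf k.+1 z zK) _.
    by rewrite ler_piMr// exprn_ile1//; lra.
  rewrite EFinM lee_pmul2l ?lte_fin ?powR_gt0// EFinD leeD//.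
    by rewrite -GE; apply: (@int_pow_subset R n mu O) => //; exact: E_holo.
  by rewrite EFinM lee_wpmul2l// lee_fin powR_ge0.
have := bound (Num.bound `|2 `^ r * (G + 4 `^ r * V)|).
have := archi_boundP (normr_ge0 (2 `^ r * (G + 4 `^ r * V))).
have := ler_norm (2 `^ r * (G + 4 `^ r * V)); lra.
Qed.

(** Values up to [lam] are paid for by measure and larger ones by the [L^r] mass, the factor
    [x ^ (p - r)] being decreasing in [x]. *)
Lemma powR_interpolation (x lam : R) : 0 < lam -> 0 <= x ->
  x `^ p <= lam `^ p + lam `^ (p - r) * x `^ r.
Proof.
move=> lam0 x0; have [xl|lx] := leP x lam.
  by rewrite ler_wpDr ?mulr_ge0 ?powR_ge0// ge0_ler_powR ?nnegrE// ltW.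
have xp : 0 < x by exact: lt_trans lx.
rewrite ler_wpDl ?powR_ge0//.
have -> : x `^ p = x `^ (p - r) * x `^ r.
  by rewrite -powRD ?subrK// (gt_eqF xp) implybT.
rewrite ler_wpM2r ?powR_ge0//.
have -> : p - r = - (r - p) by ring.
rewrite !powRN lef_pV2 ?posrE ?powR_gt0// ge0_ler_powR ?nnegrE ?(ltW lam0) ?(ltW xp) ?(ltW lx)//.
by rewrite subr_ge0 ltW.
Qed.

Lemma small_complement e : 0 < e -> exists m, (mu ((O : set CnB) `\` K m) < e%:E)%E.
Proof.
move=> e0; have big : ((V - e)%:E < \int[mu]_(z in (O : set CnB)) cst 1%E z)%E.
  by rewrite integral_cst// mul1e muOE lte_fin; lra.
have [|||||||m hm] := @integral_exhaustion R n mu (cst 1%E) K O _ _ _ _ _ _ _ _ big => //.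
- by move=> a b; exact: inner_set_le.
- exact: inner_set_bigcup.
exists m; move: hm; rewrite integral_cst// mul1e => hm.
have fK : (mu (K m) < +oo)%E by apply: le_lt_trans (muK m) _; rewrite ltry.
have -> : mu ((O : set CnB) `\` K m) = (mu (O : set CnB) - mu (K m))%E.
  by rewrite measureD// setIidr.
rewrite muOE; move: hm fK; case: (mu (K m)) => [x| |]//=.
by rewrite -EFinB !lte_fin => ? _; lra.
Qed.

(** After scaling [f] to unit [L^p] mass, interpolation on the complement of [K m] gives at most
    [4^-1] from its small measure and [4^-1] from the uniform [L^r] bound. So at least half of the
    mass lies in [K m]. *)
Lemma concentration : exists m, forall f (a : R), E f -> int_pow mu O p f = a%:E ->
  (a%:E <= 2%:E * int_pow mu (K m) p f)%E.
Proof.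
have [M0 hM0] := uniform_bound; pose M := `|M0| + 1.
have M1 : 0 < M by rewrite ltr_wpDl.
have hM f : E f -> (int_pow mu O p f <= 1)%E -> (int_pow mu O r f <= M%:E)%E.
  move=> Ef /(hM0 f Ef)/le_trans; apply; rewrite lee_fin /M.
  by apply: le_trans (ler_norm _) _; rewrite lerDl.
(* This [lam] solves [lam ^ (p - r) * M = 4^-1]; [m] is chosen afterwards, so that the complement
   has measure below [(4 * lam ^ p)^-1]. *)
pose lam := (4 * M) `^ (r - p)^-1.
have rp : 0 < r - p by rewrite subr_gt0.
have lam0 : 0 < lam by rewrite powR_gt0// mulr_gt0.
have lamE : lam `^ (p - r) = (4 * M)^-1.
  have -> : p - r = - (r - p) by ring.
  by rewrite powRN /lam -powRrM mulVf ?gt_eqF// powRr1// mulr_ge0// ltW.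
have [|m hm] := small_complement (e := (4 * lam `^ p)^-1).
  by rewrite invr_gt0; apply: mulr_gt0; [rewrite ltr0n | exact: powR_gt0 lam0].
exists m => f a Ef fa.
have a0 : 0 <= a by rewrite -lee_fin -fa int_pow_ge0.
have [->|an0] := eqVneq a 0; first by rewrite mule_ge0 ?int_pow_ge0.
have ap : 0 < a by rewrite lt_neqAle eq_sym an0.
have hf := E_holo Ef.
pose A := (O : set CnB) `\` K m.
have mA : measurable A by exact: measurableD.
have AO : A `<=` O by exact: subDsetl.
pose c := a `^ (- p^-1).
have c0 : 0 < c by rewrite powR_gt0.
have cp : cabs (real_complex R c) `^ p = a^-1.
  by rewrite cabs_real gtr0_norm// /c -powRrM mulNr mulVf ?gt_eqF// powR_inv1.
pose h z := real_complex R c * f z.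
have Eh : E h by exact: EZ.
have h1 : int_pow mu O p h = 1%E.
  by rewrite (@int_powZ R n mu O)// cp fa -EFinM mulVf.
have hr := hM h Eh; rewrite h1 in hr; have {}hr := hr (lexx _).
have [half halfE] : exists half : R, half = 4^-1 + 4^-1 by exists (4^-1 + 4^-1).
have hA : (int_pow mu A p h <= half%:E)%E.
  apply: (@le_trans _ _ ((lam `^ p)%:E * mu A + (lam `^ (p - r))%:E * int_pow mu A r h)%E).
    have mr := measurable_cabs_pow r oO (E_holo Eh) mA AO.
    have mp := measurable_cabs_pow p oO (E_holo Eh) mA AO.
    have x0 x s : (0 <= (x `^ s)%:E :> \bar R)%E by rewrite lee_fin powR_ge0.
    rewrite -integral_cst// -(ge0_integralZl mu mA mr (fun z _ => x0 _ _) (x0 _ _)).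
    rewrite -ge0_integralD//; last 3 first.
    - by move=> z _; rewrite lee_fin powR_ge0.
    - by move=> z _; rewrite mule_ge0.
    - exact: measurable_funeM.
    apply: ge0_le_integral => //.
    - by apply: emeasurable_funD => //; exact: measurable_funeM.
    - by move=> z _; rewrite -EFinM -EFinD lee_fin powR_interpolation ?cabs_ge0.
  rewrite halfE EFinD leeD//.
    apply: (@le_trans _ _ ((lam `^ p)%:E * ((4 * lam `^ p)^-1)%:E)%E).
      by rewrite lee_wpmul2l ?lee_fin ?powR_ge0// ltW.
    rewrite -EFinM lee_fin invfM mulrCA mulfV ?mulr1//.
    by rewrite gt_eqF// powR_gt0.
  apply: (@le_trans _ _ (((4 * M)^-1)%:E * M%:E)%E).
    rewrite lamE lee_wpmul2l ?lee_fin ?invr_ge0 ?mulr_ge0 ?(ltW M1)//.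
    by apply: le_trans hr; apply: (@int_pow_subset R n mu O) => //; exact: E_holo.
  by rewrite -EFinM lee_fin invfM -mulrA mulVf ?mulr1// gt_eqF.
move: hA; rewrite (@int_powZ R n mu O)// cp.
have := int_pow_split mu p oO hf (mK m) mO (@KO m) (fun z Oz => Oz); rewrite -/A fa.
have := int_pow_ge0 mu (K m) p f; have := int_pow_ge0 mu A p f.
case: (int_pow mu A p f) => [x| |]//; case: (int_pow mu (K m) p f) => [y| |]//.
rewrite -!EFinM -EFinD !lee_fin => x0 y0 [axy]; rewrite mulrC ler_pdivrMr// halfE => hx.
lra.
Qed.

End UniformBound.

End ClosedSubspace.

(** * Finite dimension *)

(** A grid of mesh [dl / 2] in the real coordinates has finitely many cells over a bounded set, and
    each cell that meets [A] contributes one point of [A]. Real and imaginary parts each account for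
    [dl / 2]. *)
Lemma finite_net (R : realType) (n : nat) (A : set (Cn R n)) (dl : R) :
  Cn_bounded A -> 0 < dl -> exists s : seq (Cn R n),
    (forall z, z \in s -> A z) /\ forall w, A w -> exists2 z, z \in s & cdist w z <= dl.
Proof.
move=> [M hM] dl0; pose B := `|M|.
have [e eE e0] : exists2 e, e = dl / 2 & 0 < e by exists (dl / 2); rewrite ?divr_gt0.
pose N := Num.truncn ((B + B) / e).
pose idx (x : R) : 'I_N.+1 := inord (Num.truncn ((x + B) / e)).
have idx_eq x y : `|x| <= B -> `|y| <= B -> idx x = idx y -> `|x - y| <= e.
  move=> xB yB xy.
  have nn t : `|t| <= B -> 0 <= (t + B) / e.
    by rewrite ler_norml => /andP[? ?]; rewrite divr_ge0 ?(ltW e0)//; lra.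
  have lN t : `|t| <= B -> (Num.truncn ((t + B) / e) < N.+1)%N.
    rewrite ler_norml ltnS => /andP[? ?]; apply: le_truncn.
    by rewrite ler_pM2r ?invr_gt0//; lra.
  have tt : Num.truncn ((x + B) / e) = Num.truncn ((y + B) / e).
    by have := congr1 val xy; rewrite /= !inordK ?lN.
  have := truncn_itv (nn _ xB); have := truncn_itv (nn _ yB); rewrite tt.
  move: (Num.truncn _) => k; rewrite -!natr1 !ler_pdivlMr// !ltr_pdivrMr//.
  by move=> /andP[? ?] /andP[? ?]; rewrite ler_norml; apply/andP; split; lra.
pose cell (z : Cn R n) : {ffun 'I_n -> 'I_N.+1 * 'I_N.+1} :=
  [ffun j => (idx (complex.Re (z j)), idx (complex.Im (z j)))].
pose rep c : option (Cn R n) :=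
  if pselect (exists z, A z /\ cell z = c) is left h then Some (projT1 (cid h)) else None.
have hB z j : A z -> cabs (z j) <= B.
  move=> /hM zM; apply: le_trans (le_trans zM (ler_norm _)).
  by have := cabs_le_cdist z (fun=> 0) j; rewrite subr0.
exists (pmap rep (enum {ffun 'I_n -> 'I_N.+1 * 'I_N.+1})); split => [z|w Aw].
  rewrite mem_pmap => /mapP[c _]; rewrite /rep; case: pselect => // h [->].
  by case: (cid h) => x [].
have [z [Az zw] rz] : exists2 z, A z /\ cell z = cell w & rep (cell w) = Some z.
  rewrite /rep; case: pselect => [h|[]]; last by exists w.
  by exists (projT1 (cid h)) => //; case: (cid h).
exists z; first by rewrite mem_pmap; apply/mapP; exists (cell w); rewrite ?mem_enum ?rz.
apply: cdist_le => [|j]; first exact: ltW.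
have := congr1 (fun c : {ffun _ -> _} => c j) zw; rewrite !ffunE => -[h1 h2].
apply: le_trans (cabs_le_ReIm _) _; rewrite ReB ImB.
have zr t (At : A t) := le_trans (abs_Re_le (t j)) (hB t j At).
have zi t (At : A t) := le_trans (abs_Im_le (t j)) (hB t j At).
have := idx_eq _ _ (zr _ Aw) (zr _ Az) (esym h1).
have := idx_eq _ _ (zi _ Aw) (zi _ Az) (esym h2).
lra.
Qed.

(** Induction on [s]: the functions of [E] that vanish at [x] are spanned by the induction
    hypothesis, and one function that is nonzero at [x], if there is any, supplies the missing
    dimension. *)
Lemma finite_dim_of_points (R : realType) (n : nat) (O : set (Cn R n))
    (s : seq (Cn R n)) (E : set (Cn R n -> R[i])) :
  (forall f g, E f -> E g -> E (fun z => f z + g z)) ->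
  (forall (c : R[i]) f, E f -> E (fun z => c * f z)) ->
  (forall f, E f -> (forall z, z \in s -> f z = 0) -> forall z, O z -> f z = 0) ->
  finite_dim_on O E.
Proof.
elim: s E => [|x s IH] E ED EZ hE.
  by exists [::] => f Ef; exists (fun=> 0) => z Oz; rewrite big_ord0 (hE f Ef).
pose E0 := [set f | E f /\ f x = 0].
have [|||t ht] := IH E0.
- by move=> f g [Ef fx] [Eg gx]; split; [exact: ED|rewrite fx gx addr0].
- by move=> c f [Ef fx]; split; [exact: EZ|rewrite fx mulr0].
- move=> f [Ef fx] fs; apply: hE => // z; rewrite inE => /predU1P[->//|]; exact: fs.
have [[f0 Ef0 f0x]|nf0] := pselect (exists2 f0, E f0 & f0 x != 0); last first.
  exists t => f Ef; apply: ht; split=> //; apply/eqP; apply: contrapT => /negP fx.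
  by apply: nf0; exists f.
exists (f0 :: t) => f Ef; pose c0 := f x / f0 x.
have [|c hc] := ht (fun z => f z + - c0 * f0 z).
  split; first by apply: ED => //; exact: EZ.
  by rewrite mulNr /c0 divfK// subrr.
exists (fun k => if k is k'.+1 then c k' else c0) => z Oz.
by rewrite big_ord_recl /= -hc// mulNr addrC subrK.
Qed.

(** * Finite nets on which vanishing forces a function to be zero *)

Section Vanishing.
Variables (R : realType) (n : nat) (mu : {measure set (CnB R n) -> \bar R}).
Variables (O : set (Cn R n)) (p : R).
Notation K := (inner_set O).
Implicit Types (f : Cn R n -> R[i]).
Hypotheses (hmu : is_lebesgue_Cn mu) (oO : Cn_open O) (bO : Cn_bounded O) (p1 : 1 <= p).

Lemma int_pow_eq0 f : holomorphic_on O f -> int_pow mu O p f = 0%E ->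
  forall z, O z -> f z = 0.
Proof.
move=> hf f0 z Oz; have [e e0 he] := oO Oz.
have [A A0 hA] := int_pow_local_bound hmu p1 e0.
have := hA _ _ _ oO hf he; rewrite f0 mule0 lee_fin => fz.
have : cabs (f z) `^ p = 0 by apply/le_anti; rewrite fz powR_ge0.
by move/powR_eq0_eq0/cabs0_eq0.
Qed.

(** If [f] has mass [a], the local bound gives [|f| <= M] on [K m.+1], with [M ^ p = A * a].
    Vanishing on a fine net then gives [|f| <= t * M] on [K m] by the Lipschitz estimate. So the
    mass on [K m] is at most [a / 4], and concentration yields [a <= a / 2]. *)
Lemma vanishing_net (m : nat) : exists s : seq (Cn R n), forall f (a : R),
  holomorphic_on O f -> int_pow mu O p f = a%:E ->
  (a%:E <= 2%:E * int_pow mu (K m) p f)%E ->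
  (forall z, z \in s -> f z = 0) -> a = 0.
Proof.
have p0 : 0 < p by exact: lt_le_trans ltr01 p1.
have mO : measurable (O : set (CnB R n)) by exact: Cn_open_measurable.
have muO := bounded_measure_lty hmu bO mO (fun z Oz => Oz).
pose V := fine (mu (O : set (CnB R n))).
have V0 : 0 <= V by exact: fine_ge0.
have muOE : mu (O : set (CnB R n)) = V%:E by rewrite fineK// ge0_fin_numE.
have [Lam LamE Lam0] : exists2 Lam : R, Lam = 2048 & 0 < Lam.
  by exists 2048; [reflexivity | rewrite ltr0n].
have [rho rhoE rho0] : exists2 rho : R, rho = 2^-1 ^+ m.+1 & 0 < rho.
  by exists (2^-1 ^+ m.+1); rewrite ?exprn_gt0.
have [A A0 hA] := int_pow_local_bound hmu p1 rho0.
have AV : 0 < 4 * (A * (V + 1)) by rewrite !mulr_gt0// ltr_wpDl.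
have [t [t0 t1 tA]] : exists t : R, [/\ 0 < t, t <= 1 & t * (4 * (A * (V + 1))) <= 1].
  exists (Num.min 1 (4 * (A * (V + 1)))^-1); split.
  - by rewrite lt_min ltr01 invr_gt0.
  - by rewrite ge_min lexx.
  - by rewrite -ler_pdivlMr// mul1r ge_min lexx orbT.
(* The first bound is the range of the Lipschitz estimate on radius [rho]; the second turns its
   constant [Lam * M / rho] into [t * M]. *)
have [dl [dl0 dl1 dl2]] : exists dl : R, [/\ 0 < dl, dl <= rho / 8 & dl <= t * rho / Lam].
  exists (Num.min (rho / 8) (t * rho / Lam)); split.
  - by rewrite lt_min !divr_gt0// mulr_gt0.
  - by rewrite ge_min lexx.
  - by rewrite ge_min lexx orbT.
have KO : K m `<=` O by exact: inner_set_sub.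
have [|s [sK hs]] := finite_net (A := K m) _ dl0.
  by have [M hM] := bO; exists M => z /KO; exact: hM.
exists s => f a hf fa conc fs.
have a0 : 0 <= a by rewrite -lee_fin -fa int_pow_ge0.
pose M := (A * a) `^ p^-1.
have Mp : M `^ p = A * a.
  by rewrite /M -powRrM mulVf ?gt_eqF// powRr1// mulr_ge0// ltW.
have M0 : 0 <= M by exact: powR_ge0.
have fM w : K m.+1 w -> cabs (f w) <= M.
  rewrite /inner_set /= -rhoE => /(hA _ _ _ oO hf); rewrite fa -EFinM lee_fin -Mp.
  rewrite !leNgt; apply: contra => h; apply: gt0_ltr_powR; rewrite ?nnegrE ?cabs_ge0//.
have small w : K m w -> cabs (f w) <= t * M.
  move=> Kw; have [z zs wz] := hs w Kw.
  have h2 v : cdist v z < rho -> O v /\ cabs (f v) <= M.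
    move=> /ltW; rewrite rhoE => /(inner_set_ball (sK _ zs)) Kv.
    by split; [exact: (@inner_set_sub _ _ O) Kv | exact: fM].
  have := @holomorphic_lipschitz R n O f z rho M w hf rho0 h2 (le_trans wz dl1).
  rewrite -LamE (fs _ zs) subr0 => /le_trans; apply.
  apply: (@le_trans _ _ (Lam * M / rho * (t * rho / Lam))).
    rewrite ler_wpM2l ?(le_trans wz)//.
    by apply: divr_ge0; [apply: mulr_ge0 => //; exact: ltW|exact: ltW].
  by rewrite le_eqVlt; apply/orP; left; apply/eqP; field; rewrite !gt_eqF.
have : (int_pow mu (K m) p f <= (a / 4)%:E)%E.
  have p0' := ltW p0.
  have mK : measurable (K m) by exact: inner_set_measurable.
  apply: le_trans (@int_pow_le_cst R n mu O f (K m) p (t * M) oO hf mK KO p0' small) _.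
  apply: (@le_trans _ _ (((t * M) `^ p)%:E * V%:E)%E).
    by rewrite lee_wpmul2l ?lee_fin ?powR_ge0// -muOE le_measure// inE.
  rewrite -EFinM lee_fin powRM ?(ltW t0)// Mp.
  have tp : t `^ p <= t by rewrite ge1r_powR// t0.
  have h : t `^ p * (A * a) * V <= t * (A * a) * V.
    by rewrite ler_wpM2r// ler_wpM2r// mulr_ge0// ltW.
  have : a * (t * (4 * (A * (V + 1)))) <= a * 1 by rewrite ler_wpM2l.
  have : 0 <= t * A * a by rewrite !mulr_ge0// ltW.
  lra.
move=> ha; apply/le_anti; rewrite a0 andbT.
have : (a%:E <= 2%:E * (a / 4)%:E)%E by apply: le_trans conc _; rewrite lee_wpmul2l.
by rewrite -EFinM lee_fin; lra.
Qed.

End Vanishing.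

Theorem theorem1p2 (R : realType) (n : nat)
    (mu : {measure set (CnB R n) -> \bar R}) (O : set (Cn R n))
    (p : R) (q : \bar R) (E : set (Cn R n -> R[i])) :
  is_lebesgue_Cn mu ->
  Cn_domain O -> Cn_bounded O ->
  1 <= p -> (p%:E < q)%E ->
  Bergman_subspace mu O p E -> Bergman_closed mu O p E ->
  (forall f, E f -> Bergman mu O q f) ->
  finite_dim_on O E.
Proof.
move=> hmu [oO _ _] bO p1 pq subE clE Eq.
have [EBp _ ED EZ] := subE.
have mO : measurable (O : set (CnB R n)) by exact: Cn_open_measurable.
(* An infinite [q] is replaced by [p + 1], as essentially bounded functions on a set of finite
   measure have finite [L^r] mass for every finite exponent. *)
have [r pr rE] : exists2 r, p < r & forall f, E f -> (int_pow mu O r f < +oo)%E.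
  case: q pq Eq => [r| |] //= pq Eq.
    by exists r => [|f /Eq[]//]; rewrite -lte_fin.
  exists (p + 1) => [|f /Eq[hf [M hM]]]; first by rewrite ltrDl.
  have muO := bounded_measure_lty hmu bO mO (fun z Oz => Oz).
  apply: (@le_lt_trans _ _ ((`|M| `^ (p + 1))%:E * mu (O : set (CnB R n)))%E); last first.
    by rewrite lte_mul_pinfty ?lee_fin ?powR_ge0.
  rewrite -integral_cst//; apply: ae_ge0_le_integral => //.
  - by move=> z _; rewrite lee_fin powR_ge0.
  - exact: (measurable_cabs_pow _ oO hf mO).
  - by move=> z _; rewrite lee_fin powR_ge0.
  apply: filterS hM => z hz Oz; rewrite lee_fin ge0_ler_powR ?nnegrE ?cabs_ge0//.
    by rewrite addr_ge0// (le_trans ler01).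
  exact: le_trans (hz Oz) (ler_norm _).
have [m conc] := concentration hmu oO bO p1 subE clE pr rE.
have [s hs] := vanishing_net hmu oO bO p1 m.
apply: (finite_dim_of_points (s := s) ED EZ) => f Ef fs.
have [hf fp] := EBp f Ef.
have fa : int_pow mu O p f = (fine (int_pow mu O p f))%:E.
  by rewrite fineK// ge0_fin_numE// int_pow_ge0.
have a0 := hs f _ hf fa (conc f _ Ef fa) fs.
by apply: (int_pow_eq0 hmu oO p1 hf); rewrite fa a0.
Qed.
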